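(* We have \begin{align*} \sum_{i,j,k\geq 0}\frac{q^{4i^2+3j^2+2k^2+4ij-2jk+4i+2j}}{(q^4;q^4)_i(q^4;q^4)_j(q^4;q^4)_k} &=\frac{J_4J_{4,72}J_{28,72}J_{32,72}J_{36,72}}{J_2J_8J_{14,72}J_{18,72}J_{22,72}}+\frac{2q^5J_8J_{8,72}}{J_4^2}, \\ \sum_{i,j,k\geq 0}\frac{q^{4i^2+3j^2+2k^2+4ij-2jk-2j}}{(q^4;q^4)_i(q^4;q^4)_j(q^4;q^4)_k} &=\frac{J_4J_{24}J_{12,24}}{J_2J_8J_{6,24}}+\frac{2qJ_8J_{24}}{J_4^2}, \\ \sum_{i,j,k\geq 0}\frac{q^{4i^2+3j^2+2k^2+4ij-2jk-2k}}{(q^4;q^4)_i(q^4;q^4)_j(q^4;q^4)_k} &=\frac{qJ_4J_{4,72}J_{16,72}J_{20,72}J_{36,72}}{J_2J_8J_{2,72}J_{18,72}J_{34,72}}+\frac{2J_8J_{32,72}}{J_4^2}, \\ \sum_{i,j,k\geq 0}\frac{q^{4i^2+3j^2+2k^2+4ij-2jk}}{(q^4;q^4)_i(q^4;q^4)_j(q^4;q^4)_k} &=\frac{J_4J_{8,72}J_{20,72}J_{28,72}J_{36,72}}{J_2J_8J_{10,72}J_{18,72}J_{26,72}}+\frac{2q^3J_8J_{16,72}}{J_4^2}. \end{align*}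
   Context: Throughout $|q|<1$. Notation: $(a;q)_n=\prod_{k=0}^{n-1}(1-aq^k)$, $(a;q)_\infty=\prod_{k\ge0}(1-aq^k)$, $(a_1,\dots,a_r;q)_\infty=\prod_s(a_s;q)_\infty$; $J_m:=(q^m;q^m)_\infty$ and $J_{a,m}:=(q^a,q^{m-a},q^m;q^m)_\infty$. *)

(* Defs.v *)
From mathcomp Require Import all_boot all_order all_algebra finmap complex.
From mathcomp Require Import boolp classical_sets reals topology normedtype.
From mathcomp Require Import sequences summability.

Set Implicit Arguments.
Unset Strict Implicit.
Unset Printing Implicit Defensive.

Import Order.TTheory GRing.Theory Num.Theory numFieldNormedType.Exports.
Local Open Scope ring_scope.
Local Open Scope classical_set_scope.

(* The definitions are over an arbitrary numFieldType K because it is at that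
   level that the library puts the norm topology on the field itself; they are
   meant to be used with K := R[i], the complex numbers. *)

(* Unordered convergence, along the finite subsets of I directed by inclusion.
   Over the complex numbers this is the same as absolute convergence. *)
Definition sums_to (K : numFieldType) (I : choiceType) (f : I -> K) (s : K) :
    Prop :=
  partial_sum f @ totally --> s.

Definition qpoch (K : numFieldType) (a q : K) (n : nat) : K :=
  \prod_(k < n) (1 - a * q ^+ k).

(* [lim] is total; the limit does exist when `|q| < 1 and K is complete. *)
Definition qpoch_inf (K : numFieldType) (a q : K) : K :=
  lim (qpoch a q n @[n --> \oo]).

Definition qpochs_inf (K : numFieldType) (s : seq K) (q : K) : K :=
  \prod_(a <- s) qpoch_inf a q.

(* J_m *)
Definition J1 (K : numFieldType) (q : K) (m : nat) : K :=
  qpoch_inf (q ^+ m) (q ^+ m).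

(* J_{a,m}; to be used with a <= m only, as m - a is truncated. *)
Definition J2 (K : numFieldType) (q : K) (a m : nat) : K :=
  qpochs_inf [:: q ^+ a; q ^+ (m - a); q ^+ m] (q ^+ m).

(* The general term of the triple sums, [l] being the linear part of the
   exponent. For the four [l] of the theorem the total exponent is
   nonnegative, so that the term is also meaningful at q = 0. *)
Definition triple_term (K : numFieldType) (q : K) (l : int) (i j k : nat) : K :=
  q ^ (4 * i%:Z ^+ 2 + 3 * j%:Z ^+ 2 + 2 * k%:Z ^+ 2
       + 4 * i%:Z * j%:Z - 2 * j%:Z * k%:Z + l)
  / (qpoch (q ^+ 4) (q ^+ 4) i * qpoch (q ^+ 4) (q ^+ 4) j
     * qpoch (q ^+ 4) (q ^+ 4) k).

(* Main.v *)
(* Euler's identity sums the triple series over k. Splitting the remaining sum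
   over i, j according to the parity of j turns it into an even part, whose
   inner factor is (-q^2;q^4)_m / (q^4;q^4)_2m, and an odd part, with
   (-q^4;q^4)_m / (q^4;q^4)_(2m+1) instead; each carries q^(4 I^2 + 6 m^2 + ...)
   / (q^4;q^4)_(I-m) with I = i + m, that is, it is the double sum obtained by
   iterating the Bailey chain twice on a Bailey pair in base q^4. (In the third
   identity the roles of even and odd j are exchanged.) The eight pairs needed
   come from two families of finite sums sum_k [N choose k] g(a - k) with
   g(r + 2) = lam B^(r+1) g(r), which have a closed form at the centre because
   g is antisymmetric about -1/2 or -1. The chain ends in theta series, of base
   i q for the even part and q^4 for the odd part, which the Jacobi triple
   product evaluates; the even ones are then rewritten with products of modulus
   72. All limits are instances of Tannery's theorem. The case q = 0 is separate
   because Laurent monomials in q are used throughout. *)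

Require Import Defs.
From mathcomp Require Import all_boot all_order all_algebra finmap complex.
From mathcomp Require Import boolp classical_sets reals topology normedtype.
From mathcomp Require Import sequences summability.
From mathcomp Require Import ring zify.

Set Implicit Arguments.
Unset Strict Implicit.
Unset Printing Implicit Defensive.

Import Order.TTheory GRing.Theory Num.Theory numFieldNormedType.Exports.
Local Open Scope fset_scope.
Local Open Scope ring_scope.

#[local] Existing Instance totally_filter.

(** * Unordered sums *)

Section UnorderedSums.
Context {K : numFieldType}.

(** The q-Pascal rule has two forms, and the recursion of g turns the power of B in either form into
    a shift by two, so the finite sums obey two different two-term recursions. At the fixed point of
    the reflection inherited from g the sum is its own opposite, hence zero; there a recursion loses
    one term, and the sums near the centre become products. Several points near the centre are
    reachable in this way, so one g yields four pairs. Each step of the chain multiplies the r-th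
    term by B^(r^2 + d r). Two steps add 8 r^2 to the exponent r^2: this is the 9 in every theta
    series. In the even part w = i q serves only as a square root of - q^2: the products contain
    even powers of w alone, and their base is w^18 = - q^18. In the odd part only even r contribute,
    which gives the modulus 4 * 18 = 72 at once. The binomial sums run over all integers, 1 /
    (B;B)_n being 0 for n < 0: Pascal's rule then has no boundary cases, reindexing is a shift, and
    Tannery's theorem applies with a fixed index set. *)

Lemma sums_toP (I : choiceType) (f : I -> K) s :
  sums_to f s <-> forall e : K, 0 < e -> exists A : {fset I},
    forall B : {fset I}, A `<=` B -> `|\sum_(i <- B) f i - s| <= e.
Proof.
rewrite /sums_to; split.
- move=> /cvgrPdist_le h e e0; have [A _ hA] := h e e0.
  exists A => B AB; have := hA B AB.
  by rewrite distrC /partial_sum big_seq_fsetE.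
- move=> h; apply/cvgrPdist_le => e e0; have [A hA] := h e e0.
  exists A => //= B AB; have := hA B AB.
  by rewrite distrC /partial_sum big_seq_fsetE.
Qed.

Lemma splitr3 (x : K) : x = x / 3 + (x / 3 + x / 3).
Proof. by rewrite -{1}[x](@divfK _ 3) ?pnatr_eq0// mulr_natr mulrSr mulr2n addrA. Qed.

Lemma sums_to_unique (I : choiceType) (f : I -> K) s t :
  sums_to f s -> sums_to f t -> s = t.
Proof. by move=> hs ht; exact: (cvg_unique _ hs ht). Qed.

Lemma sums_to_ext (I : choiceType) (f g : I -> K) s :
  f =1 g -> sums_to f s -> sums_to g s.
Proof. by move=> /funext ->. Qed.

Lemma sums_toD (I : choiceType) (f g : I -> K) s t :
  sums_to f s -> sums_to g t -> sums_to (fun i => f i + g i) (s + t).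
Proof.
move=> /sums_toP hs /sums_toP ht; apply/sums_toP => e e0.
have e20 : 0 < e / 2 by rewrite divr_gt0.
have [A hA] := hs _ e20; have [B hB] := ht _ e20.
exists (A `|` B) => C; rewrite fsubUset => /andP[AC BC].
rewrite big_split /= opprD addrACA.
by rewrite (splitr e); apply: (le_trans (ler_normD _ _)); apply: lerD; auto.
Qed.

Lemma sums_toZ (I : choiceType) (f : I -> K) s c :
  sums_to f s -> sums_to (fun i => c * f i) (c * s).
Proof.
move=> /sums_toP hs; apply/sums_toP => e e0.
have c1 : 0 < `|c| + 1 by rewrite ltr_wpDl.
have [A hA] := hs (e / (`|c| + 1)) (divr_gt0 e0 c1).
exists A => B AB; rewrite -mulr_sumr -mulrBr normrM.
apply: le_trans (ler_wpM2l (normr_ge0 c) (hA B AB)) _.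
rewrite mulrCA -[leRHS]mulr1 ler_pM2l// ler_pdivrMr// mul1r lerDl//.
Qed.

Lemma sums_to_fset (I : choiceType) (f : I -> K) (A : {fset I}) :
  (forall i, i \notin A -> f i = 0) -> sums_to f (\sum_(i <- A) f i).
Proof.
move=> h; apply/sums_toP => e e0; exists A => B AB.
rewrite (big_fset_incl _ AB) ?subrr ?normr0 ?ltW// => i _ /h //.
Qed.

Lemma sums_to0 (I : choiceType) : sums_to (fun _ : I => 0) (0 : K).
Proof. by have := @sums_to_fset I (fun=> 0) fset0 (fun _ _ => erefl); rewrite big_seq_fset0. Qed.

Lemma sums_to_single (I : choiceType) (f : I -> K) (j : I) :
  (forall i, i != j -> f i = 0) -> sums_to f (f j).
Proof.
move=> h; rewrite -(big_seq_fset1 +%R j f); apply: sums_to_fset => i.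
by rewrite inE => /h.
Qed.

Lemma sums_to_sum (I : choiceType) (J : Type) (r : seq J) (P : pred J) (f : J -> I -> K) (s : J -> K) :
  (forall j, sums_to (f j) (s j)) ->
  sums_to (fun i => \sum_(j <- r | P j) f j i) (\sum_(j <- r | P j) s j).
Proof.
move=> h; elim: r => [|j r ih].
  by rewrite big_nil; apply: sums_to_ext (sums_to0 I) => i; rewrite big_nil.
rewrite big_cons; case: ifP => Pj; last first.
  by apply: sums_to_ext ih => i; rewrite big_cons Pj.
by apply: sums_to_ext (sums_toD (h j) ih) => i; rewrite big_cons Pj.
Qed.

Lemma sums_to_nat (f : nat -> K) (n : nat) :
  (forall m, (n <= m)%N -> f m = 0) -> sums_to f (\sum_(m < n) f m).
Proof.
move=> h.
apply: (@sums_to_ext _ (fun i : nat => \sum_(m < n) (if i == m :> nat then f m else 0))).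
  move=> i; case: (ltnP i n) => [lin|/[dup] nlei /h ->].
    rewrite (bigD1 (Ordinal lin)) //= eqxx big1 ?addr0// => j /eqP jn.
    by case: eqP => // ij; case: jn; apply: val_inj.
  by rewrite big1// => m _; case: eqP => // im; move: nlei; rewrite im leqNgt ltn_ord.
apply: sums_to_sum => j.
have := @sums_to_single _ (fun i : nat => if i == j :> nat then f j else 0) (nat_of_ord j).
by rewrite /= eqxx; apply => i /negbTE ->.
Qed.

(** No procedure decides whether an element is a value of [h], so the induction over the elements of
    [A] uses [pselect]. *)
Lemma fset_preimage (I J : choiceType) (h : J -> I) (A : {fset I}) :
  injective h -> exists A' : {fset J}, forall j, h j \in A -> j \in A'.
Proof.
move=> hinj; suff : forall r : seq I, exists A' : {fset J}, forall j, h j \in r -> j \in A' by apply.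
elim=> [|a r [A' ih]]; first by exists fset0.
have [[j ja]|nj] := pselect (exists j, h j = a).
  exists (j |` A') => k; rewrite !inE => /orP[/eqP hk|/ih ->]; last by rewrite orbT.
  by rewrite (hinj k j) ?eqxx// hk ja.
exists A' => k; rewrite inE => /orP[/eqP hk|/ih //].
by exfalso; apply: nj; exists k.
Qed.

(** All reindexings go through this: shifts of [int], [nat] inside [int], single rows, parity
    classes, and the substitution I = i + m. *)
Lemma sums_to_inj (I J : choiceType) (h : J -> I) (f : I -> K) s :
  injective h -> (forall i, (forall j, h j <> i) -> f i = 0) ->
  sums_to f s <-> sums_to (f \o h) s.
Proof.
move=> hinj h0; split=> /sums_toP hs; apply/sums_toP => e e0.
- have [A hA] := hs e e0.
  have [A' hA'] := fset_preimage A hinj.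
  exists A' => B A'B.
  have := hA (A `|` h @` B) (fsubsetUl _ _).
  rewrite -(@big_fset_incl _ _ _ _ (h @` B)) ?fsubsetUr//.
    by rewrite big_imfset//= => x y _ _ /hinj.
  move=> i; rewrite inE => /orP[iA|-> //] niB; apply: h0 => j ji.
  move/negP: niB; apply; rewrite -ji in_imfset//=.
  by apply: (fsubsetP A'B); apply: hA'; rewrite ji.
- have [A hA] := hs e e0.
  exists (h @` A) => B AB.
  have [A' hA'] := fset_preimage B hinj.
  pose B' := [fset j in A' | h j \in B].
  have -> : \sum_(i <- B) f i = \sum_(j <- B') (f \o h) j.
    transitivity (\sum_(i <- h @` B') f i); last by rewrite big_imfset//= => x y _ _ /hinj.
    apply/esym/big_fset_incl.
      by apply/fsubsetP => _ /imfsetP[j /= + ->]; rewrite !inE => /andP[].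
    move=> i iB inB; apply: h0 => j ji; move/negP: inB; apply.
    by rewrite -ji in_imfset//= !inE ji iB hA' ?ji.
  apply: hA; apply/fsubsetP => j jA.
  have hjB : h j \in B by apply: (fsubsetP AB); rewrite in_imfset.
  by rewrite !inE hjB hA'.
Qed.

(* Cauchy's criterion for a nonnegative family: it plays the role of
   [summable] over a field where suprema are not available. *)
Definition small_tails (I : choiceType) (b : I -> K) : Prop :=
  (forall i, 0 <= b i) /\
  forall e : K, 0 < e -> exists A : {fset I}, forall B : {fset I},
    (forall i, i \in B -> i \notin A) -> \sum_(i <- B) b i <= e.

Lemma small_tails_bounded (I : choiceType) (b : I -> K) :
  small_tails b -> exists M, 0 < M /\ forall B : {fset I}, \sum_(i <- B) b i <= M.
Proof.
move=> [b0 hb]; have [A hA] := hb 1 ltr01.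
have s0 (B : {fset I}) : 0 <= \sum_(i <- B) b i by apply: sumr_ge0.
exists (\sum_(i <- A) b i + 1); split; first by rewrite ltr_wpDl.
move=> B; rewrite (big_fsetID _ (mem A)) /=; apply: lerD; last first.
  by apply: hA => i; rewrite !inE => /andP[].
rewrite -subr_ge0 (big_fsetID _ (mem B) A) /=.
rewrite (@eq_fbigl _ _ _ _ [fset x in B | x \in A] [fset x in A | x \in B]); last first.
  by move=> i; rewrite !inE andbC.
by rewrite addrAC subrr add0r sumr_ge0.
Qed.

Lemma small_tailsZ (I : choiceType) (b : I -> K) c :
  0 <= c -> small_tails b -> small_tails (fun i => c * b i).
Proof.
move=> c0 [b0 hb]; split; first by move=> i; rewrite mulr_ge0.
move=> e e0.
have c1 : 0 < c + 1 by rewrite ltr_wpDl.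
have [A hA] := hb (e / (c + 1)) (divr_gt0 e0 c1).
exists A => B AB; rewrite -mulr_sumr.
apply: le_trans (ler_wpM2l c0 (hA B AB)) _.
by rewrite mulrCA -[leRHS]mulr1 ler_pM2l// ler_pdivrMr// mul1r lerDl.
Qed.

Lemma small_tails_inj (I J : choiceType) (h : J -> I) (b : I -> K) :
  injective h -> small_tails b -> small_tails (b \o h).
Proof.
move=> hinj [b0 hb]; split=> [j|e e0]; first exact: b0.
have [A hA] := hb e e0; have [A' hA'] := fset_preimage A hinj.
exists A' => B AB; have /hA : forall i, i \in h @` B -> i \notin A.
  move=> _ /imfsetP[j /= jB ->]; apply/negP => /hA' jA'.
  by move: (AB j jB); rewrite jA'.
by rewrite big_imfset//= => x y _ _ /hinj.
Qed.

Lemma small_tails_fset (I : choiceType) (b : I -> K) (A : {fset I}) :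
  (forall i, 0 <= b i) -> (forall i, i \in A) -> small_tails b.
Proof.
move=> b0 hA; split=> // e e0; exists A => B AB.
rewrite big1_seq ?ltW// => i /andP[_ /AB]; by rewrite hA.
Qed.

(** A pair outside the rectangle has its first index outside [A] or its second outside [A']. Each
    part is at most a tail of one family times a bound for all finite sums of the other, hence the
    tolerances [e / 2 / N] and [e / 2 / M]. *)
Lemma small_tails_prod (I J : choiceType) (b : I -> K) (c : J -> K) :
  small_tails b -> small_tails c ->
  small_tails (fun p : I * J => b p.1 * c p.2).
Proof.
move=> hb hc.
have [M [M0 hM]] := small_tails_bounded hb.
have [N [N0 hN]] := small_tails_bounded hc.
case: hb hc => [b0 hb] [c0 hc].
split=> [[i j]|e e0]; first by rewrite mulr_ge0.
have [A hA] := hb (e / 2 / N) (divr_gt0 (divr_gt0 e0 (ltr0Sn _ 1)) N0).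
have [A' hA'] := hc (e / 2 / M) (divr_gt0 (divr_gt0 e0 (ltr0Sn _ 1)) M0).
have bound (X : {fset I}) (Y : {fset J}) (B : {fset I * J}) (x y : K) :
    \sum_(i <- X) b i <= x -> \sum_(j <- Y) c j <= y ->
    (forall p, p \in B -> p.1 \in X /\ p.2 \in Y) ->
    \sum_(p <- B) b p.1 * c p.2 <= x * y.
  move=> hx hy hB.
  apply: (@le_trans _ _ ((\sum_(i <- X) b i) * (\sum_(j <- Y) c j))); last first.
    by apply: ler_pM; rewrite ?sumr_ge0.
  rewrite mulr_suml; under [leRHS]eq_bigr => i _ do rewrite mulr_sumr.
  rewrite (@pair_big_dep_cond _ _ _ _ _ X (fun=> Y) xpredT (fun=> xpredT) (fun i j => b i * c j)).
  rewrite [leRHS](big_fsetID _ (mem B)) /=.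
  rewrite -[leLHS]addr0; apply: lerD; last by apply: sumr_ge0 => p _; rewrite mulr_ge0.
  rewrite le_eqVlt; apply/orP; left; apply/eqP; apply: eq_fbigl => -[i j].
  rewrite !inE /=; case: (boolP ((i, j) \in B)) => [/[dup] ijB /hB /= [iX jY]|]; last first.
    by rewrite andbF.
  by rewrite !andbT; move: iX jY => /= -> ->.
exists [fset ((i, j) : I * J) | i in A, j in A'] => B AB.
rewrite (big_fsetID _ (fun p => p.1 \in A)) /= addrC (splitr e); apply: lerD.
- apply: (@le_trans _ _ (e / 2 / N * N)); last by rewrite divfK ?gt_eqF.
  apply: (bound (fst @` [fset x in B | x.1 \notin A]) (snd @` B)) => //.
    apply: hA => _ /imfsetP[[i j] /= + ->]; by rewrite !inE => /andP[].
  move=> p; rewrite !inE => /andP[pB pA]; split; apply/imfsetP; exists p => //=.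
  by rewrite !inE pB.
- apply: (@le_trans _ _ (M * (e / 2 / M))); last by rewrite mulrC divfK ?gt_eqF.
  apply: (bound (fst @` B) (snd @` [fset x in B | x.1 \in A])) => //.
    apply: hA' => _ /imfsetP[[i j] /= + ->]; rewrite !inE => /andP[pB pA].
    by apply/negP => jA'; move/negP: (AB _ pB); apply; apply/imfset2P; exists i => //; exists j.
  move=> p; rewrite !inE => /andP[pB pA]; split; apply/imfsetP; exists p => //=.
  by rewrite !inE pB.
Qed.

(** The rate of convergence depends on the majorant only, hence is uniform in a parameter: this is
    the estimate behind both forms of Tannery's theorem. *)
Lemma small_tails_sums (I : choiceType) (b : I -> K) (f : I -> K) s e (A : {fset I}) :
  (forall i, `|f i| <= b i) -> sums_to f s ->
  (forall B : {fset I}, (forall i, i \in B -> i \notin A) -> \sum_(i <- B) b i <= e) ->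
  forall B : {fset I}, A `<=` B -> `|\sum_(i <- B) f i - s| <= e.
Proof.
move=> fb /sums_toP hs hA B AB.
have step : forall e' : K, 0 < e' -> `|\sum_(i <- B) f i - s| <= e + e'.
  move=> e' e'0; have [C hC] := hs e' e'0.
  have := hC (C `|` B) (fsubsetUl _ _).
  rewrite (big_fsetID _ (mem B)) /=.
  rewrite (@eq_fbigl _ _ _ _ [fset x in C `|` B | x \in B] B); last first.
    by move=> i; rewrite !inE; case: (i \in B); rewrite ?orbT ?andbF.
  set X := \sum_(i <- B) f i; set Y := \sum_(i <- [fset x in C `|` B | x \notin B]) f i => h.
  have -> : X - s = - Y + (X + Y - s) by rewrite [X + Y]addrC !addrA addNr add0r.
  apply: le_trans (ler_normD _ _) _; rewrite normrN; apply: lerD => //.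
  apply: (@le_trans _ _ (\sum_(i <- [fset x in C `|` B | x \notin B]) b i)).
    by apply: le_trans (ler_norm_sum _ _ _) _; apply: ler_sum.
  apply: hA => i; rewrite !inE => /andP[_]; apply: contra; exact: (fsubsetP AB).
have e0 : 0 <= e by have := hA fset0; rewrite big_seq_fset0; apply => i; rewrite inE.
(* The order of a [numFieldType] is partial, so letting [e'] tend to 0 requires both sides to be
   real. *)
have er : e \is Num.real by exact: ger0_real.
have xr : `|\sum_(i <- B) f i - s| \is Num.real by exact: ger0_real.
rewrite real_leNgt//; apply/negP => lt.
have := step ((`|\sum_(i <- B) f i - s| - e) / 2).
rewrite divr_gt0 ?subr_gt0// => /(_ isT).
rewrite -lerBlDl ler_pdivlMr ?ltr0Sn// mulr_natr mulr2n gerDl subr_le0.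
by move=> /(lt_le_trans lt); rewrite ltxx.
Qed.

Lemma cvg_fsum (I : choiceType) (T : Type) (F : set_system T) (FF : ProperFilter F)
    (f : T -> I -> K) (g : I -> K) (A : {fset I}) :
  (forall i, f t i @[t --> F] --> g i)%classic ->
  (\sum_(i <- A) f t i @[t --> F] --> \sum_(i <- A) g i)%classic.
Proof.
move=> h; elim: (enum_fset A) => [|i r ih].
  by under eq_fun do rewrite big_nil; rewrite big_nil; exact: cvg_cst.
by under eq_fun do rewrite big_cons; rewrite big_cons; exact: cvgD (h i) ih.
Qed.

(** Here the convergence of the sums is given and the summability of the limit family is the
    conclusion; in [tannery_cvg] it is the other way round. Both pass through a finite set outside
    which the majorant is small, with three errors of at most [e / 3]. *)
Lemma tannery_sums_to (I : choiceType) (T : Type) (F : set_system T)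
    (FF : ProperFilter F) (f : T -> I -> K) (g b : I -> K) (s : T -> K) S :
  small_tails b -> (forall t i, `|f t i| <= b i) ->
  (forall i, f t i @[t --> F] --> g i)%classic ->
  (forall t, sums_to (f t) (s t)) -> (s @ F --> S)%classic ->
  sums_to g S.
Proof.
move=> [b0 hb] fb fg fs sS; apply/sums_toP => e e0.
have e30 : 0 < e / 3 by rewrite divr_gt0.
have [A hA] := hb _ e30; exists A => B AB.
have := (cvg_fsum FF (A := B) fg); move/cvgrPdist_le => /(_ _ e30) h1.
move/cvgrPdist_le : sS => /(_ _ e30) h2.
have [t []] := filter_ex (filterI h1 h2).
move=> {}h1 {}h2.
have h3 := small_tails_sums (fb t) (fs t) hA AB.
have -> : \sum_(i <- B) g i - S = (\sum_(i <- B) g i - \sum_(i <- B) f t i) +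
   ((\sum_(i <- B) f t i - s t) + (s t - S)).
  by rewrite [X in _ = _ + X]subrKA subrKA.
rewrite (splitr3 e).
apply: (le_trans (ler_normD _ _)); apply: lerD => //.
apply: (le_trans (ler_normD _ _)); apply: lerD => //.
by rewrite distrC.
Qed.

Lemma tannery_cvg (I : choiceType) (T : Type) (F : set_system T)
    (FF : ProperFilter F) (f : T -> I -> K) (g b : I -> K) (s : T -> K) S :
  small_tails b -> (forall t i, `|f t i| <= b i) ->
  (forall i, f t i @[t --> F] --> g i)%classic ->
  (forall t, sums_to (f t) (s t)) -> sums_to g S ->
  (s @ F --> S)%classic.
Proof.
move=> [b0 hb] fb fg fs /sums_toP gS; apply/cvgrPdist_le => e e0.
have e30 : 0 < e / 3 by rewrite divr_gt0.
have [A hA] := hb _ e30; have [A' hA'] := gS _ e30.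
pose B := A `|` A'.
have := (cvg_fsum FF (A := B) fg); move/cvgrPdist_le => /(_ _ e30); apply: filterS => t h1.
have h3 := small_tails_sums (fb t) (fs t) hA (fsubsetUl A A').
have h4 := hA' B (fsubsetUr A A').
have -> : S - s t = (S - \sum_(i <- B) g i) + ((\sum_(i <- B) g i - \sum_(i <- B) f t i) +
   (\sum_(i <- B) f t i - s t)).
  by rewrite [X in _ = _ + X]subrKA subrKA.
rewrite (splitr3 e).
apply: (le_trans (ler_normD _ _)); apply: lerD; first by rewrite distrC.
by apply: (le_trans (ler_normD _ _)); apply: lerD.
Qed.

Lemma sums_to_row (I J : choiceType) (f : J -> K) (i : I) s :
  sums_to f s -> sums_to (fun p : I * J => if p.1 == i then f p.2 else 0) s.
Proof.
move=> hs; apply/(@sums_to_inj _ _ (fun j => (i, j))).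
- by move=> j k [].
- move=> [i' j] h /=; case: eqP => // ii'; exfalso; apply: (h j); by rewrite ii'.
- by apply: sums_to_ext hs => j /=; rewrite eqxx.
Qed.

(** Iterated summation is an instance of Tannery's theorem: the parameter is a finite set of rows,
    the family is [f] restricted to these rows, and each term is eventually constant along
    inclusion. *)
Lemma sums_to_prod (I J : choiceType) (f : I * J -> K) (b : I * J -> K) (g : I -> K) S :
  small_tails b -> (forall p, `|f p| <= b p) ->
  (forall i, sums_to (fun j => f (i, j)) (g i)) -> sums_to g S -> sums_to f S.
Proof.
move=> hb fb hg gS.
apply: (@tannery_sums_to _ {fset I} (@totally I) (totally_filter)
  (fun A p => if p.1 \in A then f p else 0) _ b (fun A => \sum_(i <- A) g i)) => //.
- move=> A p; case: ifP => // _; rewrite normr0; by case: hb.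
- move=> p; apply/cvgrPdist_le => e e0; exists [fset p.1] => // A /= /fsubsetP/(_ p.1).
  rewrite inE eqxx => /(_ isT) ->; by rewrite subrr normr0 ltW.
- move=> A.
  apply: (@sums_to_ext _ (fun p => \sum_(i <- A) (if p.1 == i then f (i, p.2) else 0))).
    move=> [i j] /=; case: ifP => iA.
      rewrite (big_fsetD1 i iA) /= eqxx big1_seq ?addr0// => k /andP[_].
      by rewrite !inE => /andP[/negbTE ki _]; rewrite eq_sym ki.
    by rewrite big1_seq// => k /andP[_ kA]; case: eqP => // ik; move: iA; rewrite ik kA.
  apply: sums_to_sum => i; exact: (sums_to_row i (hg i)).
- apply: cvg_trans gS; apply: near_eq_cvg; apply: nearW => A.
  by rewrite /partial_sum big_seq_fsetE.
Qed.

End UnorderedSums.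

Arguments sums_toZ [K I f s] c _.
Arguments sums_to_sum [K I J] r P [f s] _.

(* All that is needed from the completeness of the complex numbers. The rest
   is over an abstract numFieldType, where the norm topology is inferred. *)
Definition geometrically_complete (K : numFieldType) : Prop :=
  (forall z : K, `|z| < 1 -> (z ^+ n @[n --> \oo] --> 0)%classic) /\
  (forall (u : nat -> K) (c z : K), `|z| < 1 ->
     (forall n, `|u n.+1 - u n| <= c * `|z| ^+ n) -> cvg (u n @[n --> \oo])%classic).

Section ComplexLimits.
Context {R : realType}.
Local Notation C := (R[i] : numFieldType).

Lemma normc_real (x : R) : `|x%:C%C| = `|x|%:C%C :> C.
Proof. by rewrite normc_def /= expr0n /= addr0 sqrtr_sqr. Qed.

Lemma normc_ge_Im (z : C) : `|complex.Im z|%:C%C <= `|z|.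
Proof.
have := normc_ge_Re (z * 'i%C); rewrite ReiNIm normrN normrM.
by rewrite [X in _ * X]normc_def /= expr0n/= add0r expr1n sqrtr1 mulr1.
Qed.

Lemma pos_real (e : C) : 0 < e -> exists2 r : R, 0 < r & e = r%:C%C.
Proof.
case: e => a b; rewrite ltcE /= => /andP[/eqP b0 a0]; exists a => //.
by rewrite b0.
Qed.

Lemma complex_expr_cvg0 (z : C) : `|z| < 1 -> (z ^+ n @[n --> \oo] --> 0)%classic.
Proof.
move=> z1; have [r r0 zr] : exists2 r : R, 0 <= r & `|z| = r%:C%C.
  by rewrite normc_def; eexists; last reflexivity; exact: sqrtr_ge0.
have r1 : `|r| < 1 by rewrite ger0_norm// -ltcR -zr.
apply/cvgrPdist_le => e /pos_real[d d0 ->].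
have /cvgrPdist_le/(_ d d0) := cvg_expr r1.
apply: filterS => n; rewrite !sub0r !normrN normrX => h.
by rewrite normrX zr -rmorphXn lecR -(ger0_norm r0).
Qed.

Lemma real_complex_cvg (u : nat -> R) (l : R) :
  (u n @[n --> \oo] --> l)%classic -> (((u n)%:C%C : C) @[n --> \oo] --> (l%:C%C : C))%classic.
Proof.
move=> /cvgrPdist_le ul; apply/cvgrPdist_le => e /pos_real[d d0 ->].
by apply: filterS (ul d d0) => n h; rewrite -rmorphB normc_real lecR.
Qed.

Lemma geometric_steps_cvg (u : nat -> R) (c r : R) : 0 <= r < 1 ->
  (forall n, `|u n.+1 - u n| <= c * r ^+ n) -> cvg (u n @[n --> \oo])%classic.
Proof.
move=> /andP[r0 r1] hu.
have h : cvgn (series (telescope u)).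
  apply: normed_cvg; apply: (@series_le_cvg _ _ (geometric c r)).
  - by move=> n /=.
  - by move=> n /=; exact: le_trans (normr_ge0 _) (hu n).
  - by move=> n /=; exact: hu.
  - apply: is_cvg_geometric_series; by rewrite ger0_norm.
have -> : u = (fun n => u 0%N + series (telescope u) n).
  by apply/funext => n; rewrite {1}(eq_sum_telescope u).
by apply: is_cvgD => //; exact: is_cvg_cst.
Qed.

Lemma complex_geometric_steps_cvg (u : nat -> C) (c z : C) : `|z| < 1 ->
  (forall n, `|u n.+1 - u n| <= c * `|z| ^+ n) -> cvg (u n @[n --> \oo])%classic.
Proof.
move=> z1 hu; have [r r0 zr] : exists2 r : R, 0 <= r & `|z| = r%:C%C.
  by rewrite normc_def; eexists; last reflexivity; exact: sqrtr_ge0.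
have r1 : r < 1 by rewrite -ltcR -zr.
have [d cd] : exists d : R, c = d%:C%C.
  (* [c] is only a complex number; the bound at n = 0 makes it nonnegative, hence real, so that it
     can bound the real and imaginary parts. *)
  have : 0 <= c by apply: le_trans (normr_ge0 _) _; last by have := hu 0%N; rewrite expr0 mulr1; apply.
  by move=> /ger0_real/complex_realP[d ->]; exists d.
have hR : cvg (complex.Re (u n) @[n --> \oo])%classic.
  apply: (@geometric_steps_cvg _ d r); rewrite ?r0// => n.
  rewrite -lecR rmorphM rmorphXn /= -cd -zr; apply: le_trans (hu n).
  rewrite -raddfB; exact: normc_ge_Re.
have hI : cvg (complex.Im (u n) @[n --> \oo])%classic.
  apply: (@geometric_steps_cvg _ d r); rewrite ?r0// => n.
  rewrite -lecR rmorphM rmorphXn /= -cd -zr; apply: le_trans (hu n).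
  rewrite -raddfB; exact: normc_ge_Im.
have -> : u = (fun n => ((complex.Re (u n))%:C%C : C) + ('i%C : C) * ((complex.Im (u n))%:C%C : C)).
  by apply/funext => n; rewrite -complexE.
apply: is_cvgD; first by apply: cvgP; exact: (real_complex_cvg hR).
apply: is_cvgM; first exact: is_cvg_cst.
by apply: cvgP; exact: (real_complex_cvg hI).
Qed.

Lemma complex_geometrically_complete : geometrically_complete C.
Proof. by split; [exact: complex_expr_cvg0 | exact: complex_geometric_steps_cvg]. Qed.

End ComplexLimits.

(** * Geometric majorants *)

Section GeometricSeries.
Context {K : numFieldType} (Kc : geometrically_complete K).

Lemma small_tails_expr (x : K) : 0 <= x < 1 -> small_tails (fun n : nat => x ^+ n).
Proof.
move=> /andP[x0 x1]; split=> [n|e e0]; first exact: exprn_ge0.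
have x1' : 0 < 1 - x by rewrite subr_gt0.
have xx : `|x| < 1 by rewrite ger0_norm.
have := Kc.1 _ xx; move/cvgrPdist_le => /(_ (e * (1 - x)) (mulr_gt0 e0 x1')).
move=> [N _ hN]; exists [fset i in iota 0 N] => B BN.
have {}hN := hN N (leqnn N); rewrite sub0r normrN ger0_norm ?exprn_ge0// in hN.
have [M hM] : exists M, forall i, i \in B -> (i < M)%N.
  exists (\max_(i <- B) i.+1) => i iB.
  by rewrite (big_fsetD1 i iB) leq_max ltnSn.
have -> : \sum_(i <- B) x ^+ i = \sum_(N <= i < M | i \in B) x ^+ i.
  rewrite -[RHS]big_filter; apply: perm_big; apply: uniq_perm.
  - exact: fset_uniq.
  - by rewrite filter_uniq ?iota_uniq.
  move=> i; rewrite mem_filter mem_index_iota.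
  case: (boolP (i \in B)) => //= iB; rewrite hM// andbT.
  by have := BN i iB; rewrite !inE mem_iota leq0n add0n /= -leqNgt => ->.
apply: (@le_trans _ _ (\sum_(N <= i < M) x ^+ i)).
  by rewrite big_mkcond; apply: ler_sum => i _; case: ifP => // _; rewrite exprn_ge0.
have [MN|NM] := leqP M N; first by rewrite big_geq// ltW.
(* Multiplied by 1 - x the sum telescopes to x^N - x^M, and x^N is at most e (1 - x) by the choice
   of [N]. *)
rewrite -(ler_pM2r x1') mulr_suml.
under eq_bigr do rewrite mulrBr mulr1 -exprSr.
rewrite (@telescope_sumr_eq _ N M (fun i => - x ^+ i)) ?(ltnW NM)//; last first.
  by move=> i _; rewrite opprK addrC.
by rewrite opprK addrC; apply: le_trans hN; rewrite lerBlDr lerDl exprn_ge0.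
Qed.

Lemma small_tails_absz (x : K) : 0 <= x < 1 -> small_tails (fun r : int => x ^+ `|r|%N).
Proof.
move=> hx.
(* Sign and absolute value determine an integer, so the family is the restriction of a product
   family on [bool * nat]. *)
have h : injective (fun r : int => ((r < 0)%R, `|r|%N)).
  by move=> [m|m] [n|n] //= [] // ->.
have hb : small_tails (fun _ : bool => 1 : K).
  apply: (@small_tails_fset _ _ _ [fset true; false]) => //.
  by case; rewrite !inE.
have := small_tails_inj h (small_tails_prod hb (small_tails_expr hx)).
by congr small_tails; apply/funext => r /=; rewrite mul1r.
Qed.

End GeometricSeries.

(** * q-Pochhammer symbols *)

Section QPochhammer.
Context {K : numFieldType}.
Implicit Types (a q B : K) (n : nat).

Lemma qpoch0 a q : qpoch a q 0 = 1.
Proof. by rewrite /qpoch big_ord0. Qed.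

Lemma qpochS a q n : qpoch a q n.+1 = qpoch a q n * (1 - a * q ^+ n).
Proof. by rewrite /qpoch big_ord_recr. Qed.

Lemma qpochSl a q n : qpoch a q n.+1 = (1 - a) * qpoch (a * q) q n.
Proof.
rewrite /qpoch big_ord_recl expr0 mulr1; congr (_ * _); apply: eq_bigr => i _.
by rewrite -mulrA -exprS.
Qed.

Lemma qpochM a q m n : qpoch a q (m + n) = qpoch a q m * qpoch (a * q ^+ m) q n.
Proof.
by elim: n => [|n ih]; rewrite ?addn0 ?qpoch0 ?mulr1// addnS !qpochS ih exprD !mulrA.
Qed.

Lemma qpochD2 a q n : qpoch a q (n * 2) = qpoch a (q ^+ 2) n * qpoch (a * q) (q ^+ 2) n.
Proof.
elim: n => [|n ih]; first by rewrite !qpoch0 mulr1.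
by rewrite mulSn !qpochS ih -!exprM -!mulrA -exprS [(2 * n)%N]mulnC; ring.
Qed.

Lemma qpochD3 a q n : qpoch a q (n * 3) =
  qpoch a (q ^+ 3) n * qpoch (a * q) (q ^+ 3) n * qpoch (a * q ^+ 2) (q ^+ 3) n.
Proof.
elim: n => [|n ih]; first by rewrite !qpoch0 !mulr1.
by rewrite mulSn !qpochS ih -!exprM [(3 * n)%N]mulnC !exprS; ring.
Qed.

Lemma qpoch_mulN a q n : qpoch a q n * qpoch (- a) q n = qpoch (a ^+ 2) (q ^+ 2) n.
Proof.
rewrite /qpoch -big_split; apply: eq_bigr => i _ /=.
by rewrite -exprM mulnC exprM; ring.
Qed.

Lemma one_sub_neq0 (x : K) : `|x| < 1 -> 1 - x != 0.
Proof. by apply: contraTneq => /subr0_eq <-; rewrite normr1 ltxx. Qed.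

Lemma norm_mul_expr_lt1 a q n : `|a| < 1 -> `|q| < 1 -> `|a * q ^+ n| < 1.
Proof.
move=> a1 q1; rewrite normrM normrX.
by apply: le_lt_trans a1; apply: ler_piMr => //; apply: exprn_ile1 => //; apply: ltW.
Qed.

Lemma qpoch_neq0 a q n : `|a| < 1 -> `|q| < 1 -> qpoch a q n != 0.
Proof.
move=> a1 q1; rewrite /qpoch prodf_seq_neq0; apply/allP => i _ /=.
by apply: one_sub_neq0; exact: norm_mul_expr_lt1.
Qed.

Lemma cvg_bounded (u : nat -> K) (l : K) : (u n @[n --> \oo] --> l)%classic ->
  exists M, 0 < M /\ forall n, `|u n| <= M.
Proof.
move=> /cvgrPdist_le/(_ 1 ltr01)[N _ hN].
exists (\sum_(i < N) `|u i| + `|l| + 1).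
have s0 : 0 <= \sum_(i < N) `|u i| by apply: sumr_ge0.
split=> [|n]; first by rewrite ltr_wpDl ?addr_ge0.
have [nN|Nn] := ltnP n N.
  rewrite (bigD1 (Ordinal nN)) //= -!addrA lerDl !addr_ge0//.
  by apply: sumr_ge0.
rewrite -addrA -[leLHS]add0r; apply: lerD => //.
rewrite -[u n](subrK l) addrC; apply: le_trans (ler_normD _ _) _; apply: lerD => //.
by rewrite distrC; exact: hN.
Qed.

Context (Kc : geometrically_complete K).

Lemma expr_small q (a : K) : `|q| < 1 -> exists N, 2 * `|a| * `|q| ^+ N <= 1 - `|q|.
Proof.
move=> q1; have nq1 : `| `|q| | < 1 by rewrite normr_id.
have h : (2 * `|a| * `|q| ^+ n @[n --> \oo] --> 2 * `|a| * 0)%classic.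
  by apply: cvgM; [exact: cvg_cst | exact: Kc.1].
rewrite mulr0 in h.
have q1' : 0 < 1 - `|q| by rewrite subr_gt0.
move/cvgrPdist_le : h => /(_ _ q1')[N _ hN]; exists N.
have := hN N (leqnn N); rewrite sub0r normrN ger0_norm//.
by rewrite !mulr_ge0// exprn_ge0.
Qed.

(* The induction compares |(a;q)_(N+n)| with |(a;q)_N| times an affine function
   of |q|^n, chosen so that one more factor 1 - a q^(N+n) preserves the bound. *)
Lemma qpoch_two_sided a q : `|q| < 1 -> exists N, forall n,
  `|qpoch a q N| / 2 <= `|qpoch a q (N + n)| <= `|qpoch a q N| * 2.
Proof.
move=> q1; have [N hN] := expr_small a q1; exists N => n.
set c := `|a| * `|q| ^+ N; rewrite -mulrA -/c in hN.
have c0 : 0 <= c by rewrite mulr_ge0 ?exprn_ge0.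
have s01 k : 0 <= `|q| ^+ k <= 1.
  by rewrite exprn_ge0//= exprn_ile1// ltW.
suff h : `|qpoch a q N| * ((1 + `|q| ^+ n) / 2) <= `|qpoch a q (N + n)|
     <= `|qpoch a q N| * (2 - `|q| ^+ n).
  have /andP[s0 s1] := s01 n; case/andP: h => h1 h2; apply/andP; split.
    apply: le_trans h1; apply: ler_wpM2l => //.
    by rewrite -[leLHS]mul1r ler_wpM2r ?invr_ge0// lerDl.
  by apply: (le_trans h2); apply: ler_wpM2l => //; rewrite gerBl.
elim: n => [|n /andP[ih1 ih2]].
  rewrite addn0 expr0 (_ : (1 + 1) / 2 = 1); last by field.
  by rewrite (_ : 2 - 1 = 1) ?mulr1 ?lexx//; ring.
have /andP[s0 s1] := s01 n; set s := `|q| ^+ n in s0 s1 ih1 ih2 *.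
have d0 : 0 <= 1 - `|q| - 2 * c by rewrite subr_ge0.
have cs : `|a * q ^+ (N + n)| = c * s by rewrite exprD mulrA !normrM !normrX.
have cs1 : c * s <= 1.
  apply: (@le_trans _ _ (2 * c)).
    rewrite mulr2n mulrDl mul1r; apply: (@le_trans _ _ c); first exact: ler_piMr.
    by rewrite lerDl.
  by apply: le_trans hN _; rewrite gerBl.
rewrite addnS qpochS normrM exprS -/s; apply/andP; split.
  apply: (@le_trans _ _ (`|qpoch a q N| * ((1 + s) / 2) * (1 - c * s))).
    rewrite -mulrA ler_wpM2l// -subr_ge0.
    rewrite (_ : _ - _ = s * ((1 - `|q| - 2 * c) + c * (1 - s)) / 2); last by field.
    by rewrite divr_ge0// mulr_ge0// addr_ge0// mulr_ge0// subr_ge0.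
  apply: ler_pM => //; first by rewrite mulr_ge0// divr_ge0// addr_ge0.
    by rewrite subr_ge0.
  rewrite -cs; apply: le_trans (lerB_normD _ _).
  by rewrite normr1 normrN.
apply: (@le_trans _ _ (`|qpoch a q N| * (2 - s) * (1 + c * s))).
  apply: ler_pM => //.
  by apply: le_trans (ler_normB _ _) _; rewrite normr1 cs.
rewrite -mulrA ler_wpM2l// -subr_ge0.
rewrite (_ : _ - _ = s * ((1 - `|q| - 2 * c) + c * s)); last by ring.
by rewrite mulr_ge0// addr_ge0// mulr_ge0.
Qed.

Lemma qpoch_cvg a q : `|q| < 1 ->
  (qpoch a q n @[n --> \oo] --> qpoch_inf a q)%classic.
Proof.
move=> q1; have [N hN] := qpoch_two_sided a q1.
have : cvg (qpoch a q (N + n) @[n --> \oo])%classic.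
  apply: (Kc.2 _ (`|qpoch a q N| * 2 * `|a * q ^+ N|) q q1) => n.
  rewrite addnS qpochS -{2}[qpoch a q (N + n)]mulr1 -mulrBr addrC addKr normrM normrN.
  rewrite exprD mulrA [X in _ * X]normrM normrX mulrA ler_wpM2r ?exprn_ge0//.
  by rewrite ler_wpM2r//; have /andP[] := hN n.
move=> /cvg_ex[l hl].
have {}hl : (qpoch a q n @[n --> \oo] --> l)%classic.
  rewrite -(cvg_shiftn N); apply: cvg_trans hl.
  by apply: near_eq_cvg; apply: nearW => n; rewrite addnC.
by rewrite /qpoch_inf (cvg_lim _ hl).
Qed.

Lemma qpoch_inf_eq a q (l : K) : `|q| < 1 ->
  (qpoch a q n @[n --> \oo] --> l)%classic -> qpoch_inf a q = l.
Proof. by move=> q1 hl; rewrite /qpoch_inf (cvg_lim _ hl). Qed.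

Lemma qpoch_inf_neq0 a q : `|a| < 1 -> `|q| < 1 -> qpoch_inf a q != 0.
Proof.
move=> a1 q1; have [N hN] := qpoch_two_sided a q1.
have p0 : 0 < `|qpoch a q N| / 2 by rewrite divr_gt0// normr_gt0 qpoch_neq0.
apply/eqP => l0; have := qpoch_cvg (a := a) q1; rewrite l0.
move/cvgrPdist_lt => /(_ _ p0)[M _ hM].
have := hM (N + M)%N (leq_addl _ _); rewrite sub0r normrN.
by have /andP[h _] := hN M => /(le_lt_trans h); rewrite ltxx.
Qed.

Lemma qpoch_bounded a q : `|q| < 1 ->
  exists M, 0 < M /\ forall n, `|qpoch a q n| <= M.
Proof. by move=> q1; apply: cvg_bounded (qpoch_cvg (a := a) q1). Qed.

(** The full sequence is known to converge, so a subsequence identifies its limit: dissections of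
    finite products of length 2n or 3n pass directly to infinite products. *)
Lemma qpoch_inf_unique (u : nat -> nat) a q (l : K) : `|q| < 1 ->
  (forall n, (n <= u n)%N) ->
  (qpoch a q (u n) @[n --> \oo] --> l)%classic -> qpoch_inf a q = l.
Proof.
move=> q1 hu hl; apply: cvg_unique hl => //.
apply: (cvg_comp u (qpoch a q) _ (qpoch_cvg (a := a) q1)).
by move=> A [N _ hN]; exists N => // n /= Nn; apply: hN => /=; apply: leq_trans (hu n).
Qed.

Lemma qpoch_infS a q : `|q| < 1 -> qpoch_inf a q = (1 - a) * qpoch_inf (a * q) q.
Proof.
move=> q1; apply: (@qpoch_inf_unique S) => //.
under eq_fun do rewrite qpochSl.
by apply: cvgM; [exact: cvg_cst | exact: qpoch_cvg].
Qed.

Lemma norm_expr_lt1 q n : `|q| < 1 -> (0 < n)%N -> `|q ^+ n| < 1.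
Proof. by move=> q1 n0; rewrite normrX exprn_ilt1// -lt0n. Qed.

Lemma qpoch_inf_dissect2 a q : `|q| < 1 ->
  qpoch_inf a q = qpoch_inf a (q ^+ 2) * qpoch_inf (a * q) (q ^+ 2).
Proof.
move=> q1; apply: (@qpoch_inf_unique (muln^~ 2)) => // [n|]; first by rewrite leq_pmulr.
under eq_fun do rewrite qpochD2.
by apply: cvgM; apply: qpoch_cvg; exact: norm_expr_lt1.
Qed.

Lemma qpoch_inf_dissect3 a q : `|q| < 1 ->
  qpoch_inf a q = qpoch_inf a (q ^+ 3) * qpoch_inf (a * q) (q ^+ 3)
    * qpoch_inf (a * q ^+ 2) (q ^+ 3).
Proof.
move=> q1; apply: (@qpoch_inf_unique (muln^~ 3)) => // [n|]; first by rewrite leq_pmulr.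
under eq_fun do rewrite qpochD3.
by do 2?apply: cvgM; apply: qpoch_cvg; exact: norm_expr_lt1.
Qed.

Lemma qpoch_inf_mulN a q : `|q| < 1 ->
  qpoch_inf a q * qpoch_inf (- a) q = qpoch_inf (a ^+ 2) (q ^+ 2).
Proof.
move=> q1; apply/esym/qpoch_inf_eq; first exact: norm_expr_lt1.
under eq_fun do rewrite -qpoch_mulN.
by apply: cvgM; exact: qpoch_cvg.
Qed.

(** The value 0 for n < 0 is the extension for which [qfact_inv_rec] holds at every integer: at n =
    0 the factor 1 - B^0 vanishes. *)
Definition qfact_inv B (n : int) : K := if n is Posz m then (qpoch B B m)^-1 else 0.

Lemma qfact_inv_neg B (n : int) : n < 0 -> qfact_inv B n = 0.
Proof. by case: n. Qed.

Lemma qfact_inv_rec B (n : int) : `|B| < 1 -> B != 0 ->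
  qfact_inv B (n - 1) = (1 - B ^ n) * qfact_inv B n.
Proof.
move=> B1 B0; case: n => [[|n]|n].
- by rewrite expr0z subrr mul0r.
- rewrite (_ : Posz n.+1 - 1 = Posz n); last by lia.
  rewrite /= qpochS invfM mulrCA -exprS -exprnP divff ?mulr1//.
  by apply: one_sub_neq0; apply: norm_expr_lt1.
- by rewrite /= mulr0; case: n.
Qed.

Lemma qpoch_inv_cvg B : `|B| < 1 ->
  ((qpoch B B n)^-1 @[n --> \oo] --> (qpoch_inf B B)^-1)%classic.
Proof. by move=> B1; apply: cvgV; [exact: qpoch_inf_neq0 | exact: qpoch_cvg]. Qed.

Lemma qfact_inv_bounded B : `|B| < 1 ->
  exists M, 0 < M /\ forall n : int, `|qfact_inv B n| <= M.
Proof.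
move=> B1; have [M [M0 hM]] := cvg_bounded (qpoch_inv_cvg B1); exists M; split=> // -[n|n].
  exact: hM.
by rewrite /= normr0 ltW.
Qed.

Lemma qfact_inv_cvg B (u : nat -> int) : `|B| < 1 -> (forall n, exists N, forall m, (N <= m)%N -> (n%:Z <= u m)) ->
  (qfact_inv B (u n) @[n --> \oo] --> (qpoch_inf B B)^-1)%classic.
Proof.
move=> B1 hu; have /cvgrPdist_le h := qpoch_inv_cvg B1.
apply/cvgrPdist_le => e e0; have [N _ hN] := h e e0.
have [N' hN'] := hu N; exists N' => // m /= /hN'.
by case: (u m) => //= k; rewrite lez_nat => Nk; exact: hN.
Qed.

End QPochhammer.

(** * Integer powers and sums over the integers *)

Section Powers.
Context {K : numFieldType}.
Implicit Types (v : K).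

Lemma normr_exprz v (e : int) : `|v ^ e| = `|v| ^ e.
Proof. by case: e => n; rewrite ?normrX//= normfV normrX. Qed.

(** Most majorants come from this: an exponent that is at least n up to an additive constant c costs
    only the factor |v|^(-c). *)
Lemma norm_exprz_le v (e c : int) (n : nat) : v != 0 -> `|v| < 1 ->
  n%:Z <= e + c -> `|v ^ e| <= `|v| ^ (- c) * `|v| ^+ n.
Proof.
move=> v0 v1 le_n; have [d hd] : exists d : nat, e = - c + n%:Z + d%:Z.
  by exists (absz (e + c - n%:Z)%R); lia.
have nv0 : `|v| != 0 by rewrite normr_eq0.
rewrite normr_exprz hd !expfzDr// ler_piMr//.
  by rewrite mulr_ge0 ?exprz_ge0.
by rewrite exprn_ile1// ltW.
Qed.

Lemma norm_exprz_le0 v (e : int) (n : nat) : v != 0 -> `|v| < 1 ->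
  n%:Z <= e -> `|v ^ e| <= `|v| ^+ n.
Proof.
move=> v0 v1 le_n; have := @norm_exprz_le v e 0 n v0 v1.
by rewrite addr0 oppr0 expr0z mul1r; apply.
Qed.

Lemma sums_to_shift (f : int -> K) s (a : int) :
  sums_to f s <-> @sums_to K int (fun k : int => f (k + a)) s.
Proof.
apply: (@sums_to_inj _ int int (fun k => k + a)); first exact: addIr.
by move=> i h; case: (h (i - a)); rewrite subrK.
Qed.

Lemma sums_to_Posz (f : int -> K) s : (forall k, k < 0 -> f k = 0) ->
  sums_to f s <-> sums_to (fun k : nat => f k%:Z) s.
Proof.
move=> h; apply: (@sums_to_inj _ _ _ Posz) => [m n []//|[m|m] hm].
  by case: (hm m).
exact: h.
Qed.

End Powers.

(** * Euler's sum and the Jacobi triple product *)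

Section QBinomial.
Context {K : numFieldType} (Kc : geometrically_complete K).
Variable B : K.
Hypotheses (B0 : B != 0) (B1 : `|B| < 1).
Let iq := qfact_inv B.

(** The q-Pascal rule [n+1, k] = [n, k] + B^(n+1-k) [n, k-1], divided by (B;B)_n. *)
Lemma qfact_inv_pascal (n : nat) (k : int) :
  (1 - B ^+ n.+1) * (iq k * iq (n.+1%:Z - k)) =
  iq k * iq (n%:Z - k) + B ^ (n.+1%:Z - k) * (iq (k - 1) * iq (n.+1%:Z - k)).
Proof.
rewrite (_ : n%:Z - k = n.+1%:Z - k - 1); last by lia.
rewrite /iq !qfact_inv_rec//.
have -> : B ^+ n.+1 = B ^ (n.+1%:Z - k) * B ^ k by rewrite -expfzDr// subrK.
by ring.
Qed.

Lemma qfact_invS (n : nat) : iq n%:Z = (1 - B ^+ n.+1) * iq n.+1%:Z.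
Proof. by rewrite (_ : n%:Z = n.+1%:Z - 1) ?[iq (_ - 1)]qfact_inv_rec//; lia. Qed.

Lemma one_sub_exprS_neq0 (n : nat) : 1 - B ^+ n.+1 != 0.
Proof. by apply: one_sub_neq0; apply: norm_expr_lt1. Qed.

(** The square root [v] of [B] expresses B^(k(k-1)/2) without halving an integer. Euler's sum and
    the triple product are both obtained from this finite theorem by letting n grow. *)
Lemma q_binomial (v z : K) (n : nat) : B = v ^+ 2 -> z != 0 ->
  sums_to (fun k : int => qpoch B B n * (iq k * iq (n%:Z - k)) * (z ^ k * v ^ (k * (k - 1))))
    (qpoch (- z) B n).
Proof.
move=> Bv z0; have v0 : v != 0 by move: B0; rewrite Bv expf_eq0.
elim: n => [|n ih].
  have -> : qpoch (- z) B 0 = qpoch B B 0 * (iq 0 * iq (0%:Z - 0)) * (z ^ 0 * v ^ (0 * (0 - 1))).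
    by rewrite /iq /= !qpoch0 mul0r !expr0z invr1 !mulr1.
  apply: (@sums_to_single _ _ (fun k : int => qpoch B B 0 * (iq k * iq (0%:Z - k)) * (z ^ k * v ^ (k * (k - 1)))) 0).
  move=> k k0; rewrite /iq; have [kn|kp|k00] := ltgtP k 0.
  - by rewrite qfact_inv_neg// !(mul0r, mulr0).
  - by rewrite [qfact_inv B (0 - k)]qfact_inv_neg ?subr_lt0// !(mul0r, mulr0).
  - by rewrite k00 eqxx in k0.
rewrite [qpoch (- z) B n.+1]qpochS mulNr opprK mulrDr mulr1.
rewrite [X in sums_to _ (_ + X)](_ : _ = z * v ^ (2 * n%:Z) * qpoch (- z) B n); last first.
  by rewrite mulrC Bv -exprM -exprnP.
have := sums_toD ih (sums_toZ (z * v ^ (2 * n%:Z)) ((sums_to_shift _ _ (-1)).1 ih)).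
apply: sums_to_ext => k.
rewrite qpochS -exprS -[qpoch B B n * (1 - _) * _]mulrA qfact_inv_pascal.
rewrite (_ : n%:Z - (k - 1) = n.+1%:Z - k); last by lia.
have -> : z ^ k = z * z ^ (k - 1).
  by rewrite -{2}[z]expr1z -expfzDr//; congr (_ ^ _); ring.
have -> : B ^ (n.+1%:Z - k) = v ^ (2 * (n.+1%:Z - k)) by rewrite Bv -exprz_exp.
have -> : v ^ (k * (k - 1)) = v ^ (2 * (k - 1)) * v ^ ((k - 1) * (k - 1 - 1)).
  by rewrite -expfzDr//; congr (_ ^ _); ring.
have -> : v ^ (2 * (n.+1%:Z - k)) = v ^ (2 * n%:Z) * (v ^ (2 * (k - 1)))^-1.
  by rewrite invr_expz -expfzDr//; congr (_ ^ _); rewrite -[n.+1]addn1 PoszD; ring.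
field; by rewrite expfz_neq0.
Qed.

End QBinomial.

Section Theta.
Context {K : numFieldType} (Kc : geometrically_complete K).

Lemma small_tails_expr_norm (v : K) : `|v| < 1 -> small_tails (fun n : nat => `|v| ^+ n).
Proof. by move=> v1; apply: small_tails_expr Kc _ _; rewrite normr_ge0. Qed.

Lemma small_tails_absz_norm (v : K) : `|v| < 1 -> small_tails (fun r : int => `|v| ^+ `|r|%N).
Proof. by move=> v1; apply: small_tails_absz Kc _ _; rewrite normr_ge0. Qed.

Lemma euler_sum (v : K) (m : int) : v != 0 -> `|v| < 1 ->
  sums_to (fun k : nat => v ^ (k%:Z ^+ 2 - k%:Z + m * k%:Z) * qfact_inv (v ^+ 2) k%:Z)
    (qpoch_inf (- v ^ m) (v ^+ 2)).
Proof.
move=> v0 v1; set B := v ^+ 2.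
have B1 : `|B| < 1 by apply: norm_expr_lt1.
have B0 : B != 0 by rewrite expf_neq0.
apply/(@sums_to_Posz _ (fun k => v ^ (k ^+ 2 - k + m * k) * qfact_inv B k)).
  by move=> k k0; rewrite qfact_inv_neg// mulr0.
have [M [M0 hM]] := qpoch_bounded Kc B B1.
have [N [N0 hN]] := qfact_inv_bounded Kc B1.
(* The constant comes from k <= k^2 - k + m k + (2 - m)^2, which is x^2 - x y + y^2 >= 0 at x = k, y
   = 2 - m. *)
pose b (k : int) := M * (N * N) * `|v| ^ (- (2 - m) ^+ 2) * `|v| ^+ `|k|%N.
have fin n := q_binomial B0 B1 (n := n) (erefl B) (expfz_neq0 m v0).
refine (tannery_sums_to (F := \oo%classic) _ (b := b) _ _ _ fin _).
- apply: small_tailsZ (small_tails_absz_norm v1).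
  by rewrite !mulr_ge0 ?exprz_ge0 ?normr_ge0 ?(ltW M0) ?(ltW N0).
- move=> n k; have [k0|k0] := ltP k 0.
    rewrite qfact_inv_neg// !(mul0r, mulr0) normr0.
    by rewrite !mulr_ge0 ?exprz_ge0 ?exprn_ge0 ?normr_ge0 ?(ltW M0) ?(ltW N0).
  rewrite exprz_exp -expfzDr// !normrM /b -[leRHS]mulrA; apply: ler_pM => //.
    by rewrite !mulr_ge0.
    by rewrite !ler_pM ?mulr_ge0.
  by apply: norm_exprz_le => //; nia.
- move=> k.
  have -> : v ^ (k ^+ 2 - k + m * k) * qfact_inv B k =
      qpoch_inf B B * (qfact_inv B k * (qpoch_inf B B)^-1) * ((v ^ m) ^ k * v ^ (k * (k - 1))).
    rewrite exprz_exp -expfzDr// [m * k + _](_ : _ = k ^+ 2 - k + m * k); last by ring.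
    by field; exact: (qpoch_inf_neq0 Kc B1 B1).
  apply: cvgM; last exact: cvg_cst.
  apply: cvgM; first exact: qpoch_cvg.
  apply: cvgM; first exact: cvg_cst.
  apply: qfact_inv_cvg => // n; exists (n + `|k|)%N => p; lia.
- exact: qpoch_cvg.
Qed.

(** This is the q-binomial theorem of order 2n at [- z n], recentred at n. The last n factors are
    (w^(a+b);B)_n; reversing the first n, whose powers may be negative, gives (w^(a-b);B)_n times a
    monomial ([low]), which cancels the one created by recentring. *)
Lemma finite_triple_product (w : K) (a b n : nat) : (b < a)%N -> w != 0 -> `|w| < 1 ->
  let B := w ^+ (2 * a) in
  sums_to (fun r : int => qpoch B B (n + n) * (qfact_inv B (n%:Z + r) * qfact_inv B (n%:Z - r))
      * ((-1) ^ r * w ^ (a%:Z * r ^+ 2 + b%:Z * r)))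
    (qpoch (w ^+ (a - b)) B n * qpoch (w ^+ (a + b)) B n).
Proof.
move=> ba w0 w1 B.
have B1 : `|B| < 1 by apply: norm_expr_lt1 => //; lia.
have B0 : B != 0 by rewrite expf_neq0.
have N10 : (-1 : K) != 0 by rewrite oppr_eq0 oner_eq0.
pose z (k : nat) := w ^ (b%:Z + a%:Z - 2 * a%:Z * k%:Z).
have BE (k : nat) : B ^+ k = w ^ (2 * a%:Z * k%:Z) by rewrite /B -exprM exprnP; congr (_ ^ _); lia.
have low k : qpoch (z k) B k = (-1) ^ k%:Z * w ^ (b%:Z * k%:Z - a%:Z * k%:Z ^+ 2) * qpoch (w ^+ (a - b)) B k.
  elim: k => [|k ih]; first by rewrite !qpoch0 /= expr0z !mulr0 subr0 !mulr1.
  rewrite qpochSl (_ : z k.+1 * B = z k); last first.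
    rewrite -[B]expr1 BE /z -expfzDr//; congr (_ ^ _); rewrite -[k.+1]addn1 PoszD; ring.
  have abE : w ^+ (a - b) = w ^ (a%:Z - b%:Z) by rewrite exprnP; congr (_ ^ _); lia.
  rewrite ih [qpoch (w ^+ (a - b)) B k.+1]qpochS BE [X in 1 - X * _]abE -expfzDr//.
  rewrite /z -[k.+1]addn1 PoszD [(-1) ^ (_ + _)]expfzDr//.
  set X := w ^ (_ - _ * (_ + _)%R); set Y := w ^ (a%:Z - b%:Z + _).
  have XY : X * Y = 1.
    by rewrite /X /Y -expfzDr// -[RHS](expr0z w); congr (_ ^ _); ring.
  have -> : w ^ (b%:Z * (k%:Z + 1) - a%:Z * (k%:Z + 1) ^+ 2) = w ^ (b%:Z * k%:Z - a%:Z * k%:Z ^+ 2) * X.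
    by rewrite /X -expfzDr//; congr (_ ^ _); ring.
  transitivity ((X * Y - X) * ((-1) ^ k%:Z * w ^ (b%:Z * k%:Z - a%:Z * k%:Z ^+ 2) * qpoch (w ^+ (a - b)) B k)).
    by rewrite XY.
  by rewrite expr1z; ring.
have zn : - z n != 0 by rewrite oppr_eq0 expfz_neq0.
have := q_binomial B0 B1 (v := w ^+ a) (n := n + n) _ zn.
rewrite opprK [qpoch (z n) B _]qpochM low (_ : z n * B ^+ n = w ^+ (a + b)); last first.
  rewrite BE /z -expfzDr// [RHS]exprnP PoszD; congr (_ ^ _); ring.
have Ba : B = (w ^+ a) ^+ 2 by rewrite /B mulnC exprM.
move=> /(_ Ba).
move=> /(sums_to_shift _ _ n%:Z)/(sums_toZ ((-1) ^ n%:Z * w ^ (a%:Z * n%:Z ^+ 2 - b%:Z * n%:Z))).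
set S := (X in sums_to _ X -> _); have -> : S = qpoch (w ^+ (a - b)) B n * qpoch (w ^+ (a + b)) B n.
  rewrite /S; set X := w ^ _; set Y := w ^ _.
  have XY : X * Y = 1 by rewrite /X /Y -expfzDr// -[RHS](expr0z w); congr (_ ^ _); ring.
  have NN : (-1) ^ n%:Z * (-1) ^ n%:Z = 1 :> K by rewrite -expfzMl mulrNN mulr1 exp1rz.
  transitivity (((-1) ^ n%:Z * (-1) ^ n%:Z) * (X * Y) * (qpoch (w ^+ (a - b)) B n * qpoch (w ^+ (a + b)) B n)).
    ring.
  by rewrite NN XY !mul1r.
apply: sums_to_ext => r.
rewrite (_ : (n + n)%:Z - (r + n%:Z) = n%:Z - r); last by lia.
rewrite (_ : r + n%:Z = n%:Z + r); last by ring.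
rewrite /z expNrz [(-1) ^ (_ + _)]expfzDr// exprz_exp.
rewrite [(w ^+ a) ^ _](_ : _ = w ^ (a%:Z * ((n%:Z + r) * (n%:Z + r - 1)))); last first.
  by rewrite [w ^+ a]exprnP exprz_exp.
set X := w ^ (a%:Z * _ - _); set Y := w ^ (_ * _); set Z := w ^ (a%:Z * (_ * _)).
have -> : w ^ (a%:Z * r ^+ 2 + b%:Z * r) = X * (Y * Z).
  by rewrite /X /Y /Z -!expfzDr//; congr (_ ^ _); ring.
have NN : (-1) ^ n%:Z * (-1) ^ n%:Z = 1 :> K by rewrite -expfzMl mulrNN mulr1 exp1rz.
set P := qpoch B B _; set I1 := qfact_inv _ _; set I2 := qfact_inv _ _.
transitivity (((-1) ^ n%:Z * (-1) ^ n%:Z) * (P * (I1 * I2) * ((-1) ^ r * (X * (Y * Z))))); last by rewrite NN mul1r.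
ring.
Qed.

Definition triple_product (w : K) (a b : nat) : K :=
  qpoch_inf (w ^+ (a - b)) (w ^+ (2 * a)) * qpoch_inf (w ^+ (a + b)) (w ^+ (2 * a))
  * qpoch_inf (w ^+ (2 * a)) (w ^+ (2 * a)).

Lemma jacobi_triple_product (w : K) (a b : nat) : (b < a)%N -> w != 0 -> `|w| < 1 ->
  sums_to (fun r : int => (-1) ^ r * w ^ (a%:Z * r ^+ 2 + b%:Z * r)) (triple_product w a b).
Proof.
move=> ba w0 w1; set B := w ^+ (2 * a).
have B1 : `|B| < 1 by apply: norm_expr_lt1 => //; lia.
have B0 : B != 0 by rewrite expf_neq0.
have PB0 : qpoch_inf B B != 0 by exact: (qpoch_inf_neq0 Kc B1 B1).
have [M [M0 hM]] := qpoch_bounded Kc B B1.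
have [N [N0 hN]] := qfact_inv_bounded Kc B1.
(* The additive constant is 0, because b < a gives |r| <= a r^2 + b r. *)
pose b' (r : int) := M * (N * N) * `|w| ^ (- 0) * `|w| ^+ `|r|%N.
have fin n := @finite_triple_product w a b n ba w0 w1.
have -> : triple_product w a b = qpoch_inf B B * (qpoch_inf (w ^+ (a - b)) B * qpoch_inf (w ^+ (a + b)) B).
  by rewrite mulrC.
have N1 (r : int) : `|(-1) ^ r| = 1 :> K by rewrite normr_exprz normrN1 exp1rz.
suff h : sums_to (fun r : int => (qpoch_inf B B)^-1 * ((-1) ^ r * w ^ (a%:Z * r ^+ 2 + b%:Z * r)))
    (qpoch_inf (w ^+ (a - b)) B * qpoch_inf (w ^+ (a + b)) B).
  by apply: sums_to_ext (sums_toZ (qpoch_inf B B) h) => r; rewrite mulVKf.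
refine (tannery_sums_to (F := \oo%classic) _ (b := b') _ _ _ fin _).
- apply: small_tailsZ (small_tails_absz_norm w1).
  by rewrite !mulr_ge0 ?exprz_ge0 ?normr_ge0 ?(ltW M0) ?(ltW N0).
- move=> n r; rewrite !normrM N1 mul1r /b' -[leRHS]mulrA; apply: ler_pM => //.
    by rewrite !mulr_ge0.
    by rewrite !ler_pM ?mulr_ge0.
  apply: norm_exprz_le => //; case: r => r; nia.
- move=> r.
  have -> : (qpoch_inf B B)^-1 * ((-1) ^ r * w ^ (a%:Z * r ^+ 2 + b%:Z * r)) =
      qpoch_inf B B * ((qpoch_inf B B)^-1 * (qpoch_inf B B)^-1) * ((-1) ^ r * w ^ (a%:Z * r ^+ 2 + b%:Z * r)).
    by field.
  apply: cvgM; last exact: cvg_cst.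
  apply: cvgM.
    apply: (cvg_comp (fun n => (n + n)%N) (qpoch B B) _ (qpoch_cvg Kc B1)).
    by move=> A [k _ hk]; exists k => // n /= kn; apply: hk => /=; lia.
  apply: cvgM; apply: qfact_inv_cvg => // n; exists (n + `|r|)%N => p; lia.
- by apply: cvgM; apply: qpoch_cvg.
Qed.

End Theta.

(** * Bailey pairs *)

Section Bailey.
Context {K : numFieldType} (Kc : geometrically_complete K).
Variable B : K.
Hypotheses (B0 : B != 0) (B1 : `|B| < 1).
Let iq := qfact_inv B.

(** The q-Vandermonde sum with one upper entry sent to infinity. Pascal's rule on t and M + 1 - t
    splits the sum for M + 1 into the one for M with [w] and, after t -> t - 1, the one for M with
    [w + 1], so [w] varies in the induction. *)
Lemma q_vandermonde (M : nat) (w : int) :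
  sums_to (fun t : int => B ^ (t * (t + w)) * (iq (M%:Z - t) * iq t * iq (t + w)))
    (iq M%:Z * iq (M%:Z + w)).
Proof.
elim: M w => [|M ih] w.
  have -> : iq 0%:Z * iq (0%:Z + w) = B ^ (0 * (0 + w)) * (iq (0%:Z - 0) * iq 0 * iq (0 + w)).
    by rewrite mul0r expr0z /iq /= qpoch0 invr1 !mul1r.
  apply: (@sums_to_single _ _ (fun t : int => B ^ (t * (t + w)) * (iq (0%:Z - t) * iq t * iq (t + w))) 0).
  move=> t t0; rewrite /iq; have [tn|tp|t00] := ltgtP t 0.
  - by rewrite [qfact_inv B t]qfact_inv_neg// !(mul0r, mulr0).
  - by rewrite [qfact_inv B (_ - t)]qfact_inv_neg ?subr_lt0// !(mul0r, mulr0).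
  - by rewrite t00 eqxx in t0.
have n0 := one_sub_exprS_neq0 B1 M.
have := sums_toD (ih w) (sums_toZ (B ^ (M.+1%:Z + w)) ((sums_to_shift _ _ (-1)).1 (ih (w + 1)))).
move=> /(sums_toZ (1 - B ^+ M.+1)^-1).
rewrite [X in sums_to _ X -> _](_ : _ = iq M.+1%:Z * iq (M.+1%:Z + w)); last first.
  rewrite (_ : M%:Z + (w + 1) = M.+1%:Z + w); last by lia.
  rewrite (_ : M%:Z + w = M.+1%:Z + w - 1); last by lia.
  by rewrite /iq (qfact_invS B0 B1 M) qfact_inv_rec//; field.
apply: sums_to_ext => t; apply: (mulfI n0); rewrite mulVKf//.
rewrite (_ : t - 1 + (w + 1) = t + w); last by ring.
rewrite (_ : M%:Z - (t - 1) = M.+1%:Z - t); last by lia.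
have p := qfact_inv_pascal B0 B1 M t.
rewrite [RHS](_ : _ = B ^ (t * (t + w)) * iq (t + w) *
   ((1 - B ^+ M.+1) * (qfact_inv B t * qfact_inv B (M.+1%:Z - t)))); last by rewrite /iq; ring.
rewrite p [RHS]mulrDr [X in _ = _ + X](_ : _ = B ^ (M.+1%:Z - t) * B ^ (t * (t + w)) *
   iq (t + w) * (iq (t - 1) * iq (M.+1%:Z - t))); last by rewrite /iq; ring.
rewrite -expfzDr// (_ : M.+1%:Z - t + t * (t + w) = M.+1%:Z + w + (t - 1) * (t + w)); last by ring.
by rewrite expfzDr// /iq; ring.
Qed.

(* The condition on r discards the terms with m < 0 of the q-Vandermonde sum; it
   fails for some r (e.g. d = 2, r = -1), where the c r below must vanish. *)
Lemma bailey_lemma_sum (d I : nat) (r : int) : 0 <= r \/ r + d%:Z <= 0 ->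
  \sum_(m < I.+1) B ^ (m%:Z ^+ 2 + d%:Z * m%:Z) *
     (iq (I%:Z - m%:Z) * (iq (m%:Z - r) * iq (m%:Z + r + d%:Z))) =
  B ^ (r ^+ 2 + d%:Z * r) * (iq (I%:Z - r) * iq (I%:Z + r + d%:Z)).
Proof.
move=> hr.
pose F (m : int) := B ^ (m ^+ 2 + d%:Z * m) *
     (iq (I%:Z - m) * (iq (m - r) * iq (m + r + d%:Z))).
have hF : sums_to F (B ^ (r ^+ 2 + d%:Z * r) * (iq (I%:Z - r) * iq (I%:Z + r + d%:Z))).
  have [Ir|rI] := ltP I%:Z r.
    rewrite /iq [qfact_inv B (I%:Z - r)]qfact_inv_neg ?subr_lt0// !(mul0r, mulr0).
    apply: sums_to_ext (sums_to0 int) => m; rewrite /F /iq.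
    have [mI|Im] := leP m I%:Z.
      by rewrite [qfact_inv B (m - r)]qfact_inv_neg ?subr_lt0 ?(le_lt_trans mI)// !(mul0r, mulr0).
    by rewrite [qfact_inv B (_ - m)]qfact_inv_neg ?subr_lt0// !(mul0r, mulr0).
  have [M hM] : exists M : nat, M%:Z = I%:Z - r by exists (absz (I%:Z - r)%R); lia.
  have := (sums_to_shift _ _ (- r)).1 (q_vandermonde (M := M) (w := 2 * r + d%:Z)).
  move=> /(sums_toZ (B ^ (r ^+ 2 + d%:Z * r))).
  rewrite hM (_ : I%:Z - r + (2 * r + d%:Z) = I%:Z + r + d%:Z); last by ring.
  apply: sums_to_ext => m; rewrite /F.
  rewrite (_ : I%:Z - r - (m - r) = I%:Z - m); last by ring.
  rewrite (_ : m - r + (2 * r + d%:Z) = m + r + d%:Z); last by ring.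
  rewrite (_ : m ^+ 2 + d%:Z * m = r ^+ 2 + d%:Z * r + (m - r) * (m + r + d%:Z)); last by ring.
  by rewrite [in RHS]expfzDr//; ring.
have h1 : sums_to (fun m : nat => F m%:Z) (\sum_(m < I.+1) F m%:Z).
  apply: (@sums_to_nat _ (fun m => F m%:Z)) => m Im; rewrite /F /iq.
  by rewrite [qfact_inv B (_ - m%:Z)]qfact_inv_neg ?subr_lt0// !(mul0r, mulr0).
apply: sums_to_unique h1 _; apply/sums_to_Posz => // m m0; rewrite /F /iq.
case: hr => hr.
  by rewrite [qfact_inv B (m - r)]qfact_inv_neg ?(mul0r, mulr0)//; lia.
by rewrite [qfact_inv B (m + r + _)]qfact_inv_neg ?(mul0r, mulr0)//; lia.
Qed.

(* A Bailey pair relative to B^d, with the two-sided sequence c in place of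
   alpha. *)
Definition bailey_pair (d : nat) (c : int -> K) (beta : nat -> K) : Prop :=
  forall m : nat,
    sums_to (fun r : int => c r * (iq (m%:Z - r) * iq (m%:Z + r + d%:Z))) (beta m).

(** Exchanging the finite sum over m with the series in r leaves [bailey_lemma_sum] for each r. *)
Lemma bailey_chain (d : nat) (c : int -> K) (beta : nat -> K) :
  (forall r, c r = 0 \/ 0 <= r \/ r + d%:Z <= 0) ->
  bailey_pair d c beta ->
  bailey_pair d (fun r => c r * B ^ (r ^+ 2 + d%:Z * r))
    (fun I => \sum_(m < I.+1) B ^ (m%:Z ^+ 2 + d%:Z * m%:Z) * iq (I%:Z - m%:Z) * beta m).
Proof.
move=> hc hb I.
apply: sums_to_ext (sums_to_sum _ _ (fun m : 'I_I.+1 =>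
  sums_toZ (B ^ (m%:Z ^+ 2 + d%:Z * m%:Z) * iq (I%:Z - m%:Z)) (hb m))) => r.
rewrite -mulrA -/iq; case: (hc r) => [->|/bailey_lemma_sum <-].
  by rewrite mul0r big1// => m _; rewrite mul0r mulr0.
by rewrite mulr_sumr; apply: eq_bigr => m _; rewrite -/iq; ring.
Qed.

Arguments bailey_chain [d c beta] _ _.

(** Two steps of the chain give [V L] both as a series in r and as a double series in I and m. As L
    grows, the former tends to [Theta] / P^2 and the latter acquires a factor 1 / P, so one P
    survives. [tannery_cvg] finds the limit and [tannery_sums_to] transfers it to the double
    series. *)
Lemma bailey_double_sum (d : nat) (c : int -> K) (beta : nat -> K) (x : K) Theta (M M' : K) :
  `|x| < 1 -> `|B| <= `|x| ->
  (forall r, c r = 0 \/ 0 <= r \/ r + d%:Z <= 0) ->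
  bailey_pair d c beta ->
  0 <= M -> (forall m : nat, `|B ^ (m%:Z ^+ 2 + d%:Z * m%:Z) * beta m| <= M * `|x| ^+ m) ->
  0 <= M' -> (forall r : int, `|c r * B ^ (2 * (r ^+ 2 + d%:Z * r))| <= M' * `|x| ^+ `|r|%N) ->
  sums_to (fun r => c r * B ^ (2 * (r ^+ 2 + d%:Z * r))) Theta ->
  sums_to (fun p : nat * nat =>
      B ^ ((p.1 + p.2)%N%:Z ^+ 2 + d%:Z * (p.1 + p.2)%N%:Z)
      * (B ^ (p.2%:Z ^+ 2 + d%:Z * p.2%:Z) * beta p.2) * iq p.1%:Z)
    (Theta / qpoch_inf B B).
Proof.
move=> x1 Bx hc hb M0 hM M'0 hM' hT.
set P := qpoch_inf B B.
have P0 : P != 0 by exact: (qpoch_inf_neq0 Kc B1 B1).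
have [N [N0 hN]] := qfact_inv_bounded Kc B1.
pose e (m : nat) := m%:Z ^+ 2 + d%:Z * m%:Z.
have hc' r : c r * B ^ (r ^+ 2 + d%:Z * r) = 0 \/ 0 <= r \/ r + d%:Z <= 0.
  by case: (hc r) => [->|h]; [left; rewrite mul0r | right].
pose b' I := \sum_(m < I.+1) B ^ e m * iq (I%:Z - m%:Z) * beta m.
pose V L := \sum_(I < L.+1) B ^ e I * iq (L%:Z - I%:Z) * b' I.
have hV : bailey_pair d (fun r => c r * B ^ (2 * (r ^+ 2 + d%:Z * r))) V.
  move=> L; have := bailey_chain hc' (bailey_chain hc hb) L.
  apply: sums_to_ext => r; congr (_ * _); rewrite -mulrA -expfzDr//.
  by congr (_ * _ ^ _); ring.
have limV : (V L @[L --> \oo] --> P^-1 * P^-1 * Theta)%classic.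
  have hT' := sums_toZ (P^-1 * P^-1) hT.
  refine (tannery_cvg (F := \oo%classic) _ (b := fun r : int => M' * (N * N) * `|x| ^+ `|r|%N) _ _ _ hV hT').
  - apply: small_tailsZ (small_tails_absz_norm Kc x1).
    by rewrite !mulr_ge0 ?(ltW N0).
  - move=> L r; rewrite normrM mulrAC; apply: ler_pM => //.
    by rewrite normrM ler_pM.
  - move=> r; rewrite [X in (_ --> X)%classic]mulrC; apply: cvgM; first exact: cvg_cst.
    by apply: cvgM; apply: qfact_inv_cvg => // n; exists (n + `|r|)%N => p; lia.
pose f (L : nat) (p : nat * nat) := B ^ e p.1 * iq (L%:Z - p.1%:Z) * (B ^ e p.2 * iq (p.1%:Z - p.2%:Z) * beta p.2).
pose g (p : nat * nat) := B ^ e p.1 * P^-1 * (B ^ e p.2 * iq (p.1%:Z - p.2%:Z) * beta p.2).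
have fV L : sums_to (f L) (V L).
  have row (I : 'I_L.+1) : sums_to (fun p : nat * nat => if p.1 == I :> nat then f L (nat_of_ord I, p.2) else 0)
      (B ^ e I * iq (L%:Z - I%:Z) * b' I).
    apply: (@sums_to_row _ _ _ (fun m : nat => f L (nat_of_ord I, m)) (nat_of_ord I)).
    apply: sums_toZ; apply: (@sums_to_nat _ (fun m => B ^ e m * iq (I%:Z - m%:Z) * beta m)) => m Im.
    by rewrite /iq qfact_inv_neg ?subr_lt0// !(mul0r, mulr0).
  apply: sums_to_ext (sums_to_sum _ _ row) => -[I m] /=.
  have [IL|LI] := ltnP I L.+1.
    rewrite (bigD1 (Ordinal IL)) //= eqxx big1 ?addr0// => j /eqP jI.
    by case: eqP => // Ij; case: jI; apply: val_inj.
  rewrite big1 => [|j _].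
    by rewrite /f /iq [qfact_inv B (L%:Z - _)]qfact_inv_neg ?subr_lt0//= !(mul0r, mulr0).
  by case: eqP => // Ij; move: LI; rewrite Ij leqNgt ltn_ord.
have hB (m : nat) : `|B ^ e m| <= `|x| ^+ m.
  have -> : B ^ e m = B ^+ (m ^ 2 + d * m) by rewrite exprnP; congr (_ ^ _); rewrite /e; lia.
  rewrite normrX; apply: (@le_trans _ _ (`|x| ^+ (m ^ 2 + d * m))).
    by apply: lerXn2r => //; rewrite nnegrE.
  rewrite (_ : (m ^ 2 + d * m = m + (m * m.-1 + d * m))%N); last by case: (m) => //= k; nia.
  by rewrite exprD ler_piMr ?exprn_ge0// exprn_ile1// ltW.
have hg : sums_to g (P^-1 * P^-1 * Theta).
  pose b (p : nat * nat) := N * (M * N) * (`|x| ^+ p.1 * `|x| ^+ p.2).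
  refine (tannery_sums_to (F := \oo%classic) _ (b := b) _ _ _ fV limV).
  - apply: small_tailsZ; first by rewrite !mulr_ge0 ?(ltW N0).
    exact: (small_tails_prod (small_tails_expr_norm Kc x1) (small_tails_expr_norm Kc x1)).
  - move=> L [I m]; rewrite /f /b /=.
    rewrite [X in `|X|](_ : _ = B ^ e I * iq (L%:Z - I%:Z) * ((B ^ e m * beta m) * iq (I%:Z - m%:Z))); last by ring.
    rewrite [leRHS](_ : _ = `|x| ^+ I * N * ((M * `|x| ^+ m) * N)); last by ring.
    rewrite !normrM; apply: ler_pM; rewrite ?mulr_ge0//; apply: ler_pM; rewrite ?mulr_ge0//.
    by rewrite -normrM; exact: hM.
  - move=> [I m]; apply: cvgM; last exact: cvg_cst.
    apply: cvgM; first exact: cvg_cst.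
    by apply: qfact_inv_cvg => // n; exists (n + I)%N => p /=; lia.
(* The double series is supported on m <= I; writing I = i + m makes the indices free. *)
have hinj : injective (fun p : nat * nat => ((p.1 + p.2)%N, p.2)).
  by move=> [i m] [i' m'] /= [] h1 h2; congr (_, _) => //; lia.
have h0 p : (forall p', ((p'.1 + p'.2)%N, p'.2) <> p) -> g p = 0.
  case: p => I m hp; rewrite /g /iq [qfact_inv B _]qfact_inv_neg ?(mul0r, mulr0)//=.
  rewrite subr_lt0 ltz_nat ltnNge; apply/negP => mI.
  by apply: (hp ((I - m)%N, m)) => /=; rewrite subnK.
have {hg} := sums_toZ P ((sums_to_inj _ hinj h0).1 hg).
rewrite (_ : P * (P^-1 * P^-1 * Theta) = Theta / P); last by field.
apply: sums_to_ext => -[i m] /=; rewrite /g /e /= PoszD addrK /iq /=.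
by field; rewrite P0 qpoch_neq0.
Qed.

End Bailey.

(** * Finite binomial sums with a closed form at the centre *)

Section PhiRecursion.
Context {K : numFieldType}.
Variables (B lam : K) (g : int -> K).
Hypotheses (B0 : B != 0) (B1 : `|B| < 1) (lam0 : lam != 0).
Hypothesis g_rec : forall r, g (r + 2) = lam * B ^ (r + 1) * g r.
Let iq := qfact_inv B.

(* [Phi N a] is the sum of [N choose k]_B g(a - k) over k. *)
Fixpoint Phi (N : nat) (a : int) : K :=
  if N is n.+1 then Phi n (a - 1) + lam * B ^ (a - 1) * Phi n (a - 2) else g a.

(** This is Pascal's rule [N+1, k] = [N, k-1] + B^k [N, k], the factor B^k being absorbed by g(a-k)
    = lam B^(a-k-1) g(a-k-2). The other form of the rule gives [PhiSr] in the same way. *)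
Lemma PhiSl N a : Phi N.+1 a = Phi N (a - 1) + lam * B ^ (a - 1) * Phi N (a - 2).
Proof. by []. Qed.

Lemma PhiSr N a : Phi N.+1 a = Phi N a + lam^-1 * B ^ (N%:Z - a) * Phi N (a + 1).
Proof.
elim: N a => [|N ih] a.
  rewrite /=.
  have -> : g a = lam * B ^ (a - 1) * g (a - 2).
    by rewrite -{1}(subrK 2 a) g_rec (_ : a - 2 + 1 = a - 1)//; ring.
  have -> : g (a + 1) = lam * B ^ a * g (a - 1).
    by rewrite (_ : a + 1 = a - 1 + 2) ?g_rec ?subrK//; ring.
  rewrite sub0r; have : B ^ (- a) * B ^ a = 1 by rewrite -expfzDr// addNr expr0z.
  move=> h; rewrite [X in _ = _ + X](_ : _ = (B ^ (- a) * B ^ a) * (lam^-1 * lam) * g (a - 1)); last by ring.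
  by rewrite h mulVf//; ring.
rewrite PhiSl (ih (a - 1)) (ih (a - 2)) [Phi N.+1 a]PhiSl [Phi N.+1 (a + 1)]PhiSl.
rewrite (_ : a - 1 + 1 = a); last by ring.
rewrite (_ : a - 2 + 1 = a - 1); last by ring.
rewrite (_ : a + 1 - 1 = a); last by ring.
rewrite (_ : a + 1 - 2 = a - 1); last by ring.
rewrite (_ : N.+1%:Z - a = N%:Z - (a - 1)); last by lia.
set X := B ^ (N%:Z - (a - 1)).
have XE : B ^ (N%:Z - (a - 2)) = X * B.
  by rewrite -{2}[B]expr1z -expfzDr//; congr (_ ^ _); ring.
have -> : B ^ a = B ^ (a - 1) * B.
  by rewrite -{3}[B]expr1z -expfzDr// subrK.
by rewrite XE; field.
Qed.

(** The reflection exchanges the recursions [PhiSl] and [PhiSr], and lam^2 = B^s is what makes their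
    coefficients agree. *)
Lemma Phi_sym (s : int) : lam ^+ 2 = B ^ s -> (forall r, g (- s - r) = - g r) ->
  forall N a, Phi N (N%:Z - s - a) = - Phi N a.
Proof.
move=> hs g_sym; elim=> [|N ih] a; first by rewrite /= sub0r g_sym.
rewrite PhiSr PhiSl.
rewrite (_ : N.+1%:Z - s - a = N%:Z - s - (a - 1)); last by lia.
rewrite (_ : N%:Z - s - (a - 1) + 1 = N%:Z - s - (a - 2)); last by ring.
rewrite (_ : N%:Z - (N%:Z - s - (a - 1)) = s + (a - 1)); last by ring.
by rewrite !ih expfzDr// -hs; field.
Qed.

Lemma Phi_sums N a :
  sums_to (fun r : int => g r * (iq (a - r) * iq (N%:Z - a + r))) (iq N%:Z * Phi N a).
Proof.
elim: N a => [|N ih] a.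
  have -> : iq 0%:Z * Phi 0 a = g a * (iq (a - a) * iq (0%:Z - a + a)).
    by rewrite subrr sub0r addNr /iq /= qpoch0 invr1 !mulr1 mul1r.
  apply: (@sums_to_single _ _ (fun r : int => g r * (iq (a - r) * iq (0%:Z - a + r))) a).
  move=> r ra; rewrite /iq; have [h|h|h] := ltgtP a r.
  - by rewrite [qfact_inv B (a - r)]qfact_inv_neg ?subr_lt0// !(mul0r, mulr0).
  - by rewrite [qfact_inv B (0%:Z - a + r)]qfact_inv_neg ?(mul0r, mulr0)//; lia.
  - by rewrite h eqxx in ra.
have n0 := one_sub_exprS_neq0 B1 N.
have := sums_toD (ih a) (sums_toZ (lam^-1 * B ^ (N%:Z - a)) ((sums_to_shift _ _ 2).1 (ih (a + 1)))).
move=> /(sums_toZ (1 - B ^+ N.+1)^-1).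
rewrite [X in sums_to _ X -> _](_ : _ = iq N.+1%:Z * Phi N.+1 a); last first.
  by rewrite PhiSr /iq (qfact_invS B0 B1 N); field; rewrite lam0.
apply: sums_to_ext => r; apply: (mulfI n0); rewrite mulVKf//.
have := qfact_inv_pascal B0 B1 N (a - r).
rewrite (_ : N.+1%:Z - (a - r) = N.+1%:Z - a + r); last by ring.
rewrite (_ : N%:Z - (a - r) = N%:Z - a + r); last by ring.
move=> p; rewrite [RHS]mulrCA p g_rec.
rewrite (_ : a + 1 - (r + 2) = a - r - 1); last by ring.
rewrite (_ : N%:Z - (a + 1) + (r + 2) = N.+1%:Z - a + r); last by lia.
rewrite (_ : N.+1%:Z - a + r = (N%:Z - a) + (r + 1)); last by lia.
by rewrite [in RHS]expfzDr// -/iq; field.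
Qed.

(** With N = 2m + d and a = m + h the denominators of the binomial sum become those of a Bailey
    pair; varying h and d yields several pairs from one [g]. *)
Lemma Phi_pair (kappa : K) (h : int) (d : nat) :
  bailey_pair B d (fun r => kappa * g (r + h))
    (fun m => kappa * (iq (m + m + d)%N%:Z * Phi (m + m + d) (m%:Z + h))).
Proof.
move=> m; have := sums_toZ kappa ((sums_to_shift _ _ h).1 (@Phi_sums (m + m + d) (m%:Z + h))).
apply: sums_to_ext => r.
rewrite (_ : m%:Z + h - (r + h) = m%:Z - r); last by ring.
rewrite (_ : (m + m + d)%N%:Z - (m%:Z + h) + (r + h) = m%:Z + r + d%:Z); last by lia.
by rewrite mulrA.
Qed.

Lemma eq_opp0 (x : K) : x = - x -> x = 0.
Proof.
move=> /eqP; rewrite -subr_eq0 opprK -mulr2n -mulr_natl mulf_eq0 pnatr_eq0 /=.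
by move=> /eqP.
Qed.

Section Symmetry1.
Hypotheses (lamB : lam ^+ 2 = B) (g_sym : forall r, g (- 1 - r) = - g r).
Variable m : nat.
Let y := lam * B ^ m%:Z.

Let sym : forall N a, Phi N (N%:Z - 1 - a) = - Phi N a.
Proof. by apply: Phi_sym; rewrite ?expr1z. Qed.

Let lamVB : lam^-1 * B = lam.
Proof. by rewrite -lamB; field. Qed.

(** The reflection a -> N - 1 - a fixes m when N = 2m + 1; this zero produces the one-term relations
    below. *)
Let mid : Phi (m + m).+1 m%:Z = 0.
Proof. by apply: eq_opp0; rewrite -sym; congr Phi; lia. Qed.

Lemma Phi1_odd_low : Phi (m + m).+1 (m%:Z - 1) = (y - 1) * Phi (m + m) m%:Z.
Proof.
rewrite PhiSr subrK.
have -> : Phi (m + m) (m%:Z - 1) = - Phi (m + m) m%:Z by rewrite -sym; congr Phi; lia.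
rewrite (_ : (m + m)%N%:Z - (m%:Z - 1) = m%:Z + 1); last by lia.
by rewrite expfzDr// expr1z mulrCA lamVB /y; ring.
Qed.

Lemma Phi1_even_step : Phi (m + m).+2 (m%:Z + 1) = y * (y - 1) * Phi (m + m) m%:Z.
Proof.
rewrite PhiSl addrK mid add0r (_ : m%:Z + 1 - 2 = m%:Z - 1); last by ring.
by rewrite Phi1_odd_low mulrA.
Qed.

Lemma Phi1_even_high : Phi (m + m) (m%:Z + 1) = - (lam / B ^ m%:Z) * Phi (m + m) m%:Z.
Proof.
have := mid; rewrite PhiSr (_ : (m + m)%N%:Z - m%:Z = m%:Z); last by lia.
have b0 : B ^ m%:Z != 0 by rewrite expfz_neq0.
move=> /eqP; rewrite addr_eq0 => /eqP ->; field.
by rewrite lam0 b0.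
Qed.

(** The point m - 2 mirrors m + 2, where the value is found by solving [PhiSr] for its second term.
    The factor 1 - B^(2m+1) arises as 1 - y^2 and later lowers (B;B)_(2m+1) to (B;B)_2m. *)
Lemma Phi1_odd_low2 : Phi (m + m).+1 (m%:Z - 2) =
  lam / B ^ m%:Z * (1 - B ^+ (m + m).+1) * Phi (m + m) m%:Z.
Proof.
have b0 : B ^ m%:Z != 0 by rewrite expfz_neq0.
have h1 : Phi (m + m).+1 (m%:Z + 1) = (1 - y) * Phi (m + m) m%:Z.
  rewrite (_ : m%:Z + 1 = (m + m).+1%:Z - 1 - (m%:Z - 1)); last by lia.
  by rewrite sym Phi1_odd_low; ring.
have h2 : Phi (m + m).+1 (m%:Z - 2) = - Phi (m + m).+1 (m%:Z + 1 + 1).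
  by rewrite -sym; congr Phi; lia.
have := Phi1_even_step; rewrite PhiSr h1 (_ : (m + m).+1%:Z - (m%:Z + 1) = m%:Z); last by lia.
rewrite h2; set X := Phi _ (m%:Z + 1 + 1) => h3.
have {}h3 : lam^-1 * B ^ m%:Z * X = y * (y - 1) * Phi (m + m) m%:Z - (1 - y) * Phi (m + m) m%:Z.
  by rewrite -h3 addrAC subrr add0r.
have -> : X = lam / B ^ m%:Z * (lam^-1 * B ^ m%:Z * X) by field; rewrite lam0 b0.
have -> : B ^+ (m + m).+1 = y ^+ 2.
  rewrite /y exprMn lamB exprS; congr (_ * _).
  by rewrite exprD expr2.
by rewrite h3; ring.
Qed.

End Symmetry1.

Section Symmetry2.
Hypotheses (lamB : lam = - B) (g_sym : forall r, g (- 2 - r) = - g r).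
Variable m : nat.

Let sym : forall N a, Phi N (N%:Z - 2 - a) = - Phi N a.
Proof. by apply: Phi_sym => //; rewrite lamB sqrrN. Qed.

(** With the reflection a -> N - 2 - a, the fixed point m - 1 occurs at the even order N = 2m. *)
Let mid : Phi (m + m) (m%:Z - 1) = 0.
Proof. by apply: eq_opp0; rewrite -sym; congr Phi; lia. Qed.

Lemma Phi2_odd_mid : Phi (m + m).+1 m%:Z = B ^ m%:Z * Phi (m + m) m%:Z.
Proof.
rewrite PhiSl mid add0r.
have -> : Phi (m + m) (m%:Z - 2) = - Phi (m + m) m%:Z by rewrite -sym; congr Phi; lia.
have -> : B ^ m%:Z = B ^ (m%:Z - 1) * B by rewrite -{3}[B]expr1z -expfzDr// subrK.
by rewrite lamB; ring.
Qed.

Lemma Phi2_even_step : Phi (m + m).+2 (m%:Z + 1) =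
  (1 + B ^+ m.+1) * (B ^ m%:Z * Phi (m + m) m%:Z).
Proof.
rewrite PhiSl addrK (_ : m%:Z + 1 - 2 = (m + m).+1%:Z - 2 - m%:Z); last by lia.
by rewrite sym Phi2_odd_mid lamB exprS -exprnP; ring.
Qed.

Let high : Phi (m + m).+1 (m%:Z + 1) = Phi (m + m) m%:Z.
Proof.
by rewrite PhiSl addrK (_ : m%:Z + 1 - 2 = m%:Z - 1) ?mid ?mulr0 ?addr0//; ring.
Qed.

Lemma Phi2_odd_low : Phi (m + m).+1 (m%:Z - 2) = - Phi (m + m) m%:Z.
Proof. by rewrite -high -sym; congr Phi; lia. Qed.

Lemma Phi2_even_low : Phi (m + m).+2 (m%:Z - 2) =
  - ((1 - B ^+ (m + m).+2) * Phi (m + m) m%:Z).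
Proof.
rewrite (_ : m%:Z - 2 = (m + m).+2%:Z - 2 - (m%:Z + 1 + 1)); last by lia.
rewrite sym PhiSl addrK high (_ : m%:Z + 1 + 1 - 2 = m%:Z); last by ring.
rewrite Phi2_odd_mid lamB expfzDr// expr1z.
by rewrite !exprS exprD -exprnP; ring.
Qed.

End Symmetry2.

End PhiRecursion.

(** * The even and odd double sums *)

Section DoubleSums.
Context {K : numFieldType} (Kc : geometrically_complete K).
Variables (q im : K).
Hypotheses (q0 : q != 0) (q1 : `|q| < 1) (im2 : im ^+ 2 = -1).
Let B := q ^+ 4.
Let iq := qfact_inv B.
Let w := im * q.

Let B0 : B != 0. Proof. exact: expf_neq0. Qed.
Let B1 : `|B| < 1. Proof. exact: norm_expr_lt1. Qed.
Let im0 : im != 0.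
Proof. by apply/eqP => h; move: im2; rewrite h expr0n => /eqP; rewrite eq_sym oppr_eq0 oner_eq0. Qed.
Let w0 : w != 0. Proof. by rewrite mulf_neq0. Qed.

Let norm_im : `|im| = 1.
Proof. by apply/eqP; rewrite -sqrp_eq1 ?normr_ge0// -normrX im2 normrN1. Qed.

Let norm_w : `|w| = `|q|. Proof. by rewrite normrM norm_im mul1r. Qed.
Let w2 : w ^+ 2 = - q ^+ 2. Proof. by rewrite exprMn im2 mulN1r. Qed.
Let w4 : w ^+ 4 = B. Proof. by rewrite (exprM w 2 2) w2 sqrrN -exprM. Qed.

Let BE (e : int) : B ^ e = q ^ (4 * e). Proof. by rewrite /B [q ^+ 4]exprnP exprz_exp. Qed.
Let BwE (e : int) : B ^ e = w ^ (4 * e). Proof. by rewrite -w4 [w ^+ 4]exprnP exprz_exp. Qed.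

Let N10 : (-1 : K) != 0. Proof. by rewrite oppr_eq0 oner_eq0. Qed.

(** The factor q^(2 m^2 + t m) is split off so that [U] stays bounded. With B^(m^2 + d m) it makes
    q^(6 m^2 + (4 d + t) m), and t >= -4 keeps this exponent at least m. *)
Lemma double_sum_of_pair (d : nat) (c : int -> K) Theta (t : int) (U : nat -> K) (C M' : K) :
  (forall r, c r = 0 \/ 0 <= r \/ r + d%:Z <= 0) ->
  bailey_pair B d c (fun m => q ^ (2 * m%:Z ^+ 2 + t * m%:Z) * U m) ->
  - 4 <= t -> 0 <= C -> (forall m, `|U m| <= C) ->
  0 <= M' -> (forall r : int, `|c r * B ^ (2 * (r ^+ 2 + d%:Z * r))| <= M' * `|q| ^+ `|r|%N) ->
  sums_to (fun r => c r * B ^ (2 * (r ^+ 2 + d%:Z * r))) Theta ->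
  sums_to (fun p : nat * nat =>
      q ^ (4 * (p.1%:Z + p.2%:Z) ^+ 2 + 4 * d%:Z * (p.1%:Z + p.2%:Z)
           + (6 * p.2%:Z ^+ 2 + (4 * d%:Z + t) * p.2%:Z)) * (iq p.1%:Z * U p.2))
    (Theta / qpoch_inf B B).
Proof.
move=> hc hb ht C0 hU M'0 hM' hT.
have Bq : `|B| <= `|q|.
  by rewrite normrX exprS ler_piMr// exprn_ile1// ltW.
have hm (m : nat) : B ^ (m%:Z ^+ 2 + d%:Z * m%:Z) * (q ^ (2 * m%:Z ^+ 2 + t * m%:Z) * U m)
    = q ^ (6 * m%:Z ^+ 2 + (4 * d%:Z + t) * m%:Z) * U m.
  by rewrite BE mulrA -expfzDr//; congr (_ ^ _ * _); ring.
have hM (m : nat) : `|B ^ (m%:Z ^+ 2 + d%:Z * m%:Z) * (q ^ (2 * m%:Z ^+ 2 + t * m%:Z) * U m)| <= C * `|q| ^+ m.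
  rewrite hm normrM mulrC; apply: ler_pM => //.
  by apply: norm_exprz_le0 => //; nia.
have := bailey_double_sum Kc B0 B1 q1 Bq hc hb C0 hM M'0 hM' hT.
apply: sums_to_ext => -[i m] /=; rewrite hm BE -/iq PoszD.
set X := q ^ (4 * _); set Y := q ^ _.
rewrite [q ^ (4 * _ + _ + _)](_ : _ = X * Y); first by rewrite /iq /=; ring.
by rewrite /X /Y -expfzDr//; congr (_ ^ _); ring.
Qed.

Lemma qpoch_qfact_inv_bounded (a : K) (u v : nat -> nat) :
  exists C, 0 <= C /\ forall m, `|qpoch a B (u m) * iq (v m)%:Z| <= C.
Proof.
have [M [M0 hM]] := qpoch_bounded Kc a B1.
have [N [N0 hN]] := qfact_inv_bounded Kc B1.
exists (M * N); split=> [|m]; first by rewrite mulr_ge0// ltW.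
by rewrite normrM ler_pM.
Qed.

(* This is (-1)^r x^(r(r+1)/2) at x = - q^2 = w^2. *)
Let gE (r : int) := (-1) ^ r * w ^ (r ^+ 2 + r).

Let gE_rec r : gE (r + 2) = - q ^+ 2 * B ^ (r + 1) * gE r.
Proof.
rewrite /gE expfzDr// [(-1) ^ 2]sqrrN expr1n mulr1 -w2 BwE.
rewrite [w ^ ((r + 2) ^+ 2 + _)](_ : _ = w ^ 2 * w ^ (4 * (r + 1)) * w ^ (r ^+ 2 + r)); first by ring.
by rewrite -!expfzDr//; congr (_ ^ _); ring.
Qed.

Let gE_sym r : gE (- 1 - r) = - gE r.
Proof.
have h : (-1) ^ (- 1 - r) = - (-1) ^ r :> K.
  rewrite (_ : - 1 - r = - (1 + r)); last by ring.
  by rewrite -exprz_inv invrN1 expfzDr// expr1z mulN1r.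
rewrite /gE h (_ : (- 1 - r) ^+ 2 + (- 1 - r) = r ^+ 2 + r) ?mulNr//; ring.
Qed.

Let lamE0 : - q ^+ 2 != 0. Proof. by rewrite oppr_eq0 expf_neq0. Qed.
Let lamEB : (- q ^+ 2) ^+ 2 = B. Proof. by rewrite sqrrN -exprM. Qed.
Let PhiE := Phi B (- q ^+ 2) gE.

Lemma PhiE_central (m : nat) : PhiE (m + m) m%:Z = q ^+ (2 * m ^ 2) * qpoch (- q ^+ 2) B m.
Proof.
elim: m => [|m ih]; first by rewrite /PhiE /= /gE qpoch0 !mul1r expr0z.
rewrite addSn addnS -[m.+1]addn1 PoszD /PhiE (Phi1_even_step B0 B1 lamE0 gE_rec lamEB gE_sym m).
have -> : q ^+ (2 * (m + 1) ^ 2) = q ^+ (2 * m ^ 2) * B ^+ m * q ^+ 2.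
  by rewrite -exprM -!exprD; congr (_ ^+ _); lia.
by rewrite -/PhiE ih addn1 qpochS -exprnP; ring.
Qed.

(** Since B = w^4, the factor B^(2 (r^2 + d r)) turns w^(r^2 + j r) into w^(9 r^2 + (j + 8 d) r),
    hence [b]. A shift h corresponds to j = 2 h + 1, and [kappa] normalises the value at r = 0 to
    1. *)
Lemma even_double_sum (kappa : K) (h j t : int) (d b : nat) (U : nat -> K) (C : K) :
  (d <= 1)%N -> (b < 9)%N -> b%:Z = j + 8 * d%:Z -> - 4 <= t ->
  (forall r, kappa * gE (r + h) = (-1) ^ r * w ^ (r ^+ 2 + j * r)) ->
  (forall m : nat, kappa * (iq (m + m + d)%N%:Z * PhiE (m + m + d) (m%:Z + h)) =
     q ^ (2 * m%:Z ^+ 2 + t * m%:Z) * U m) ->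
  0 <= C -> (forall m, `|U m| <= C) ->
  sums_to (fun p : nat * nat =>
      q ^ (4 * (p.1%:Z + p.2%:Z) ^+ 2 + 4 * d%:Z * (p.1%:Z + p.2%:Z)
           + (6 * p.2%:Z ^+ 2 + (4 * d%:Z + t) * p.2%:Z)) * (iq p.1%:Z * U p.2))
    (triple_product w 9 b / qpoch_inf B B).
Proof.
move=> d1 b9 bE t4 hc hU C0 hC.
have cE r : kappa * gE (r + h) * B ^ (2 * (r ^+ 2 + d%:Z * r)) = (-1) ^ r * w ^ (9%:Z * r ^+ 2 + b%:Z * r).
  by rewrite hc BwE -mulrA -expfzDr//; congr (_ * _ ^ _); rewrite bE; ring.
apply: (@double_sum_of_pair d (fun r => kappa * gE (r + h)) _ t U C 1) => //.
- by move=> r; right; lia.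
- move=> m; rewrite -hU.
  exact: (Phi_pair B0 B1 lamE0 gE_rec (kappa := kappa) (h := h) (d := d) (m := m)).
- move=> r; rewrite cE normrM normr_exprz normrN1 exp1rz mul1r.
  by rewrite mul1r -norm_w; apply: norm_exprz_le0; rewrite ?norm_w//; nia.
- apply: sums_to_ext (jacobi_triple_product Kc b9 w0 _); last by rewrite norm_w.
  by move=> r; rewrite cE.
Qed.

(* (-1)^(r/2) for even r, and 0 for odd r. *)
Let ur (r : int) : K := (im ^ r + (- im) ^ r) / 2.

Let im_even (n : int) (x : K) : x ^+ 2 = -1 -> x ^ (2 * n) = (-1) ^ n.
Proof. by move=> x2; rewrite -exprz_exp -x2. Qed.

Let ur_even n : ur (2 * n) = (-1) ^ n.
Proof. by rewrite /ur !im_even ?sqrrN//; field. Qed.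

Let ur_odd n : ur (2 * n + 1) = 0.
Proof.
have mim0 : - im != 0 by rewrite oppr_eq0.
by rewrite /ur !expfzDr// !im_even ?sqrrN// !expr1z mulrN subrr mul0r.
Qed.

Let parity (r : int) : exists n, r = 2 * n \/ r = 2 * n + 1.
Proof. by exists (divz r 2); lia. Qed.

Let ur_step r : ur (r + 2) = - ur r.
Proof.
have [n [->|->]] := parity r.
  rewrite (_ : 2 * n + 2 = 2 * (n + 1)); last by ring.
  by rewrite !ur_even expfzDr// expr1z mulrN1.
rewrite (_ : 2 * n + 1 + 2 = 2 * (n + 1) + 1); last by ring.
by rewrite !ur_odd oppr0.
Qed.

Let ur_sym r : ur (- 2 - r) = - ur r.
Proof.
have [n [->|->]] := parity r.
  rewrite (_ : - 2 - 2 * n = 2 * (- (1 + n))); last by ring.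
  by rewrite !ur_even -exprz_inv invrN1 expfzDr// expr1z mulN1r.
rewrite (_ : - 2 - (2 * n + 1) = 2 * (- 2 - n) + 1); last by ring.
by rewrite !ur_odd oppr0.
Qed.

Let ur_le1 r : `|ur r| <= 1.
Proof.
have [n [->|->]] := parity r; last by rewrite ur_odd normr0.
by rewrite ur_even normr_exprz normrN1 exp1rz.
Qed.

(** Antisymmetry about -1 forces the value 0 at r = -1, hence by the recursion at all odd r; at r =
    2n this is (-1)^n q^(4 n^2 + 4 n). *)
Let gO (r : int) := ur r * q ^ (r ^+ 2 + 2 * r).

Let gO_rec r : gO (r + 2) = - B * B ^ (r + 1) * gO r.
Proof.
rewrite /gO ur_step BE.
rewrite [q ^ ((r + 2) ^+ 2 + _)](_ : _ = q ^ 4 * q ^ (4 * (r + 1)) * q ^ (r ^+ 2 + 2 * r)).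
  by rewrite /B; ring.
by rewrite -!expfzDr//; congr (_ ^ _); ring.
Qed.

Let gO_sym r : gO (- 2 - r) = - gO r.
Proof.
by rewrite /gO ur_sym (_ : (- 2 - r) ^+ 2 + 2 * (- 2 - r) = r ^+ 2 + 2 * r) ?mulNr//; ring.
Qed.

Let lamO0 : - B != 0. Proof. by rewrite oppr_eq0. Qed.
Let PhiO := Phi B (- B) gO.

Lemma PhiO_central (m : nat) :
  PhiO (m + m) m%:Z = q ^ (2 * m%:Z ^+ 2 - 2 * m%:Z) * qpoch (- B) B m.
Proof.
elim: m => [|m ih].
  have h : ur 0 = 1 by exact: (ur_even 0).
  by rewrite /PhiO /= /gO qpoch0 h [LHS]mul1r [RHS]mulr1.
rewrite addSn addnS -[m.+1]addn1 PoszD /PhiO (Phi2_even_step B0 B1 lamO0 gO_rec (erefl _) gO_sym m).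
have -> : q ^ (2 * (m%:Z + 1) ^+ 2 - 2 * (m%:Z + 1)) = q ^ (2 * m%:Z ^+ 2 - 2 * m%:Z) * B ^ m%:Z.
  by rewrite BE -expfzDr//; congr (_ ^ _); ring.
by rewrite -/PhiO ih addn1 qpochS exprS; ring.
Qed.

(** Only r = 2n contributes, and there q^(9 r^2 + 2 b r) = B^(9 n^2 + b n): the base becomes [B] and
    the linear coefficient is halved. A shift h corresponds to j = 2 h + 2. *)
Lemma odd_double_sum (kappa : K) (h j t : int) (d b : nat) (U : nat -> K) (C : K) :
  (d <= 2)%N -> (b < 9)%N -> 2 * b%:Z = j + 8 * d%:Z -> - 4 <= t ->
  (forall r, kappa * gO (r + h) = ur r * q ^ (r ^+ 2 + j * r)) ->
  (forall m : nat, kappa * (iq (m + m + d)%N%:Z * PhiO (m + m + d) (m%:Z + h)) =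
     q ^ (2 * m%:Z ^+ 2 + t * m%:Z) * U m) ->
  0 <= C -> (forall m, `|U m| <= C) ->
  sums_to (fun p : nat * nat =>
      q ^ (4 * (p.1%:Z + p.2%:Z) ^+ 2 + 4 * d%:Z * (p.1%:Z + p.2%:Z)
           + (6 * p.2%:Z ^+ 2 + (4 * d%:Z + t) * p.2%:Z)) * (iq p.1%:Z * U p.2))
    (triple_product B 9 b / qpoch_inf B B).
Proof.
move=> d2 b9 bE t4 hc hU C0 hC.
have cE r : kappa * gO (r + h) * B ^ (2 * (r ^+ 2 + d%:Z * r)) = ur r * q ^ (9%:Z * r ^+ 2 + 2 * b%:Z * r).
  by rewrite hc BE -mulrA -expfzDr//; congr (_ * _ ^ _); rewrite bE; ring.
(* The constant 100 is generous for |r| <= 9 r^2 + 2 b r + 100 with b <= 8; some constant is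
   unavoidable, as b = 7, r = -1 makes the exponent negative. *)
apply: (@double_sum_of_pair d (fun r => kappa * gO (r + h)) _ t U C (`|q| ^ (- 100))) => //.
(* For d <= 2 only r = -1 can violate both inequalities, and [ur] vanishes there. *)
- move=> r; have [->|r1] := eqVneq r (-1); last by right; lia.
  by left; rewrite hc [ur (-1)](ur_odd (-1)) mul0r.
- move=> m; rewrite -hU.
  exact: (Phi_pair B0 B1 lamO0 gO_rec (kappa := kappa) (h := h) (d := d) (m := m)).
- by rewrite exprz_ge0.
- move=> r; rewrite cE normrM -[leRHS]mul1r; apply: ler_pM => //.
  by apply: norm_exprz_le => //; nia.
- apply/(@sums_to_inj _ int int (fun n => 2 * n)).
  + by move=> x y; lia.
  + move=> r hr; have [n [rn|rn]] := parity r; first by case: (hr n).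
    by rewrite cE rn ur_odd mul0r.
  + apply: sums_to_ext (jacobi_triple_product Kc b9 B0 B1) => n /=.
    rewrite cE ur_even BE; congr (_ * _ ^ _); ring.
Qed.

Let iqS n : iq n%:Z = (1 - B ^+ n.+1) * iq n.+1%:Z.
Proof. exact: qfact_invS. Qed.

Let expq (m : nat) : q ^+ (2 * m ^ 2) = q ^ (2 * m%:Z ^+ 2).
Proof. by rewrite exprnP; congr (_ ^ _); lia. Qed.

Let expqB (e : int) (m : nat) : q ^ (e - 4 * m%:Z) = q ^ e / B ^ m%:Z.
Proof. by rewrite expfzDr// BE invr_expz. Qed.

Let sgn_sub2 r : (-1) ^ (r - 2) = (-1) ^ r :> K.
Proof. by rewrite expfzDr// -[(-1) ^ (- 2)]exprz_inv invrN1 [(-1) ^ 2]sqrrN expr1n mulr1. Qed.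

Let BX0 (m : nat) : B ^ m%:Z != 0. Proof. exact: expfz_neq0. Qed.

(** Here d = 1, yet the denominator is (B;B)_2m: the factor 1 - B^(2m+1) of [Phi1_odd_low2] lowers
    it. The factor B^(-m) there is the source of t = -4. *)
Lemma even_double_sum_1 : sums_to (fun p : nat * nat =>
    q ^ (4 * (p.1%:Z + p.2%:Z) ^+ 2 + 4 * (p.1%:Z + p.2%:Z) + 6 * p.2%:Z ^+ 2) *
    (iq p.1%:Z * (qpoch (- q ^+ 2) B p.2 * iq (p.2 + p.2)%N%:Z)))
  (triple_product w 9 5 / qpoch_inf B B).
Proof.
have [C [C0 hC]] := qpoch_qfact_inv_bounded (- q ^+ 2) id (fun m => (m + m)%N).
have h := @even_double_sum (- q ^+ 2)^-1 (- 2) (- 3) (- 4) 1 5 _ C isT isT erefl isT _ _ C0 hC.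
apply: sums_to_ext (h _ _) => [p|r|m].
- by congr (_ ^ _ * _); ring.
- rewrite /gE sgn_sub2 -w2 [w ^+ 2]exprnP invr_expz mulrCA -expfzDr//.
  by congr (_ * _ ^ _); ring.
- rewrite addn1 /PhiE (Phi1_odd_low2 B0 B1 lamE0 gE_rec lamEB gE_sym m) -/PhiE PhiE_central expq.
  rewrite (iqS (m + m)) [- 4 * _]mulNr expqB; field.
  by rewrite BX0 q0.
Qed.

Lemma even_double_sum_2 : sums_to (fun p : nat * nat =>
    q ^ (4 * (p.1%:Z + p.2%:Z) ^+ 2 + 6 * p.2%:Z ^+ 2 - 4 * p.2%:Z) *
    (iq p.1%:Z * (qpoch (- q ^+ 2) B p.2 * iq (p.2 + p.2)%N%:Z)))
  (triple_product w 9 3 / qpoch_inf B B).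
Proof.
have [C [C0 hC]] := qpoch_qfact_inv_bounded (- q ^+ 2) id (fun m => (m + m)%N).
have h := @even_double_sum (- (- q ^+ 2)^-1) 1 3 (- 4) 0 3 _ C isT isT erefl isT _ _ C0 hC.
apply: sums_to_ext (h _ _) => [p|r|m].
- by congr (_ ^ _ * _); ring.
- rewrite /gE expfzDr// expr1z -w2 [w ^+ 2]exprnP invr_expz.
  rewrite [w ^ (r ^+ 2 + _)](_ : _ = w ^ (- 2) * w ^ ((r + 1) ^+ 2 + (r + 1))); first by ring.
  by rewrite -expfzDr//; congr (_ ^ _); ring.
- rewrite addn0 /PhiE (Phi1_even_high B0 B1 lamE0 gE_rec lamEB gE_sym m) -/PhiE PhiE_central expq.
  rewrite [- 4 * _]mulNr expqB; field.
  by rewrite BX0 q0.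
Qed.

Lemma even_double_sum_3 : sums_to (fun p : nat * nat =>
    q ^ (4 * (p.1%:Z + p.2%:Z) ^+ 2 + 4 * (p.1%:Z + p.2%:Z) + 6 * p.2%:Z ^+ 2 + 4 * p.2%:Z) *
    (iq p.1%:Z * (qpoch (- q ^+ 2) B p.2.+1 * iq (p.2 + p.2).+1%:Z)))
  (triple_product w 9 7 / qpoch_inf B B).
Proof.
have [C [C0 hC]] := qpoch_qfact_inv_bounded (- q ^+ 2) S (fun m => (m + m).+1).
have h := @even_double_sum (- 1) (- 1) (- 1) 0 1 7 _ C isT isT erefl isT _ _ C0 hC.
apply: sums_to_ext (h _ _) => [p|r|m].
- by congr (_ ^ _ * _); ring.
- rewrite /gE expfzDr// -[(-1) ^ (- 1)]exprz_inv invrN1 expr1z mulN1r mulrN1 mulNr opprK.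
  by congr (_ * _ ^ _); ring.
- rewrite addn1 /PhiE (Phi1_odd_low B0 B1 lamE0 gE_rec lamEB gE_sym m) -/PhiE PhiE_central expq.
  by rewrite mul0r addr0 qpochS -exprnP; ring.
Qed.

Lemma even_double_sum_4 : sums_to (fun p : nat * nat =>
    q ^ (4 * (p.1%:Z + p.2%:Z) ^+ 2 + 6 * p.2%:Z ^+ 2) *
    (iq p.1%:Z * (qpoch (- q ^+ 2) B p.2 * iq (p.2 + p.2)%N%:Z)))
  (triple_product w 9 1 / qpoch_inf B B).
Proof.
have [C [C0 hC]] := qpoch_qfact_inv_bounded (- q ^+ 2) id (fun m => (m + m)%N).
have h := @even_double_sum 1 0 1 0 0 1 _ C isT isT erefl isT _ _ C0 hC.
apply: sums_to_ext (h _ _) => [p|r|m].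
- by congr (_ ^ _ * _); ring.
- by rewrite /gE addr0 !mul1r.
- rewrite addn0 addr0 PhiE_central expq mul0r addr0; ring.
Qed.

(** The only pair with d = 2; the factor 1 - B^(2m+2) of [Phi2_even_low] lowers (B;B)_(2m+2) to
    (B;B)_(2m+1). *)
Lemma odd_double_sum_1 : sums_to (fun p : nat * nat =>
    q ^ (4 * (p.1%:Z + p.2%:Z) ^+ 2 + 8 * (p.1%:Z + p.2%:Z) + 6 * p.2%:Z ^+ 2 + 6 * p.2%:Z) *
    (iq p.1%:Z * (qpoch (- B) B p.2 * iq (p.2 + p.2).+1%:Z)))
  (triple_product B 9 7 / qpoch_inf B B).
Proof.
have [C [C0 hC]] := qpoch_qfact_inv_bounded (- B) id (fun m => (m + m).+1).
have h := @odd_double_sum (- 1) (- 2) (- 2) (- 2) 2 7 _ C isT isT erefl isT _ _ C0 hC.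
apply: sums_to_ext (h _ _) => [p|r|m].
- by congr (_ ^ _ * _); ring.
- have -> : ur r = - ur (r - 2) by rewrite -ur_step subrK.
  by rewrite /gO mulN1r mulNr; congr (- (_ * _ ^ _)); ring.
- rewrite addn2 /PhiO (Phi2_even_low B0 B1 lamO0 gO_rec erefl gO_sym m) -/PhiO PhiO_central.
  by rewrite (iqS (m + m).+1) [- 2 * _]mulNr; ring.
Qed.

Lemma odd_double_sum_2 : sums_to (fun p : nat * nat =>
    q ^ (4 * (p.1%:Z + p.2%:Z) ^+ 2 + 4 * (p.1%:Z + p.2%:Z) + 6 * p.2%:Z ^+ 2 + 2 * p.2%:Z) *
    (iq p.1%:Z * (qpoch (- B) B p.2 * iq (p.2 + p.2).+1%:Z)))
  (triple_product B 9 3 / qpoch_inf B B).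
Proof.
have [C [C0 hC]] := qpoch_qfact_inv_bounded (- B) id (fun m => (m + m).+1).
have h := @odd_double_sum (- 1) (- 2) (- 2) (- 2) 1 3 _ C isT isT erefl isT _ _ C0 hC.
apply: sums_to_ext (h _ _) => [p|r|m].
- by congr (_ ^ _ * _); ring.
- have -> : ur r = - ur (r - 2) by rewrite -ur_step subrK.
  by rewrite /gO mulN1r mulNr; congr (- (_ * _ ^ _)); ring.
- rewrite addn1 /PhiO (Phi2_odd_low B0 B1 lamO0 gO_rec erefl gO_sym m) -/PhiO PhiO_central.
  by rewrite [- 2 * _]mulNr; ring.
Qed.

Lemma odd_double_sum_3 : sums_to (fun p : nat * nat =>
    q ^ (4 * (p.1%:Z + p.2%:Z) ^+ 2 + 6 * p.2%:Z ^+ 2 - 2 * p.2%:Z) *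
    (iq p.1%:Z * (qpoch (- B) B p.2 * iq (p.2 + p.2)%N%:Z)))
  (triple_product B 9 1 / qpoch_inf B B).
Proof.
have [C [C0 hC]] := qpoch_qfact_inv_bounded (- B) id (fun m => (m + m)%N).
have h := @odd_double_sum 1 0 2 (- 2) 0 1 _ C isT isT erefl isT _ _ C0 hC.
apply: sums_to_ext (h _ _) => [p|r|m].
- by congr (_ ^ _ * _); ring.
- by rewrite /gO addr0 mul1r.
- by rewrite addn0 addr0 PhiO_central [- 2 * _]mulNr; ring.
Qed.

Lemma odd_double_sum_4 : sums_to (fun p : nat * nat =>
    q ^ (4 * (p.1%:Z + p.2%:Z) ^+ 2 + 4 * (p.1%:Z + p.2%:Z) + 6 * p.2%:Z ^+ 2 + 6 * p.2%:Z) *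
    (iq p.1%:Z * (qpoch (- B) B p.2 * iq (p.2 + p.2).+1%:Z)))
  (triple_product B 9 5 / qpoch_inf B B).
Proof.
have [C [C0 hC]] := qpoch_qfact_inv_bounded (- B) id (fun m => (m + m).+1).
have h := @odd_double_sum 1 0 2 2 1 5 _ C isT isT erefl isT _ _ C0 hC.
apply: sums_to_ext (h _ _) => [p|r|m].
- by congr (_ ^ _ * _); ring.
- by rewrite /gO addr0 mul1r.
- rewrite addn1 addr0 /PhiO (Phi2_odd_mid B0 B1 lamO0 gO_rec erefl gO_sym m) -/PhiO PhiO_central.
  rewrite [q ^ (_ + 2 * m%:Z)](_ : _ = B ^ m%:Z * q ^ (2 * m%:Z ^+ 2 - 2 * m%:Z)); first by ring.
  by rewrite BE -expfzDr//; congr (_ ^ _); ring.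
Qed.

End DoubleSums.

(** * The triple sums *)

Section TripleSums.
Context {K : numFieldType} (Kc : geometrically_complete K).
Variables (q im : K).
Hypotheses (q0 : q != 0) (q1 : `|q| < 1) (im2 : im ^+ 2 = -1).
Let B := q ^+ 4.
Let iq := qfact_inv B.
Let B1 : `|B| < 1. Proof. exact: norm_expr_lt1. Qed.

(** The first m factors are 1 + q^(c-4s) = q^(c-4s) (1 + q^(4s-c)) for s = 1, ..., m: the powers
    taken out form the monomial, and what is left is a finite product. *)
Lemma qpoch_inf_shift (c : int) (m : nat) :
  qpoch_inf (- q ^ (c - 4 * m%:Z)) B =
  q ^ (c * m%:Z - 2 * m%:Z ^+ 2 - 2 * m%:Z) * qpoch (- q ^ (4 - c)) B m * qpoch_inf (- q ^ c) B.
Proof.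
elim: m => [|m ih].
  rewrite (_ : c - 4 * 0%:Z = c); last by ring.
  rewrite (_ : c * 0%:Z - 2 * 0%:Z ^+ 2 - 2 * 0%:Z = 0); last by ring.
  by rewrite expr0z qpoch0 !mul1r.
rewrite (qpoch_infS Kc _ B1) opprK.
have -> : - q ^ (c - 4 * m.+1%:Z) * B = - q ^ (c - 4 * m%:Z).
  by rewrite mulNr /B [q ^+ 4]exprnP -expfzDr//; congr (- _ ^ _); lia.
rewrite ih qpochS mulNr opprK.
have -> : q ^ (4 - c) * B ^+ m = (q ^ (c - 4 * m.+1%:Z))^-1.
  by rewrite /B -exprM exprnP -expfzDr// invr_expz; congr (_ ^ _); lia.
have -> : q ^ (c * m.+1%:Z - 2 * m.+1%:Z ^+ 2 - 2 * m.+1%:Z) =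
    q ^ (c * m%:Z - 2 * m%:Z ^+ 2 - 2 * m%:Z) * q ^ (c - 4 * m.+1%:Z).
  by rewrite -expfzDr//; congr (_ ^ _); rewrite -[m.+1]addn1 PoszD; ring.
by field; rewrite expfz_neq0.
Qed.

Let G (al be ga : int) (i j : nat) : K :=
  q ^ (4 * i%:Z ^+ 2 + 3 * j%:Z ^+ 2 + 4 * i%:Z * j%:Z + al * i%:Z + be * j%:Z)
  * (iq i%:Z * iq j%:Z) * qpoch_inf (- q ^ (2 - 2 * j%:Z + 2 * ga)) B.

Lemma sum_over_k (al be ga : int) (i j : nat) :
  sums_to (fun k : nat =>
    q ^ (4 * i%:Z ^+ 2 + 3 * j%:Z ^+ 2 + 2 * k%:Z ^+ 2 + 4 * i%:Z * j%:Z - 2 * j%:Z * k%:Z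
         + (al * i%:Z + be * j%:Z + 2 * ga * k%:Z)) * (iq i%:Z * iq j%:Z * iq k%:Z))
   (G al be ga i j).
Proof.
have v0 : q ^+ 2 != 0 by rewrite expf_neq0.
have v1 : `|q ^+ 2| < 1 by exact: norm_expr_lt1.
have := euler_sum Kc (m := 1 - j%:Z + ga) v0 v1.
rewrite -exprM -[(2 * 2)%N]/4%N -/B -/iq [q ^+ 2]exprnP exprz_exp.
rewrite (_ : 2%:Z * (1 - j%:Z + ga) = 2 - 2 * j%:Z + 2 * ga); last by ring.
move=> /(sums_toZ (q ^ (4 * i%:Z ^+ 2 + 3 * j%:Z ^+ 2 + 4 * i%:Z * j%:Z + al * i%:Z + be * j%:Z)
  * (iq i%:Z * iq j%:Z))).
apply: sums_to_ext => k; rewrite exprz_exp.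
set X := q ^ _; set Y := q ^ _.
rewrite [q ^ (_ + (_ + 2 * ga * k%:Z))](_ : _ = X * Y); first by rewrite /iq; ring.
by rewrite /X /Y -expfzDr//; congr (_ ^ _); ring.
Qed.

(** The lower bound on the exponent gives a geometric majorant in (i, j, k), which allows the sum
    over k to be carried out first. *)
Lemma triple_sum_parity (al be ga c : int) S0 S1 :
  (forall i j k : nat, i%:Z + j%:Z + k%:Z <=
     4 * i%:Z ^+ 2 + 3 * j%:Z ^+ 2 + 2 * k%:Z ^+ 2 + 4 * i%:Z * j%:Z - 2 * j%:Z * k%:Z
         + (al * i%:Z + be * j%:Z + 2 * ga * k%:Z) + c) ->
  sums_to (fun p : nat * nat => G al be ga p.1 (p.2 + p.2)) S0 ->
  sums_to (fun p : nat * nat => G al be ga p.1 (p.2 + p.2).+1) S1 ->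
  sums_to (fun p : nat * nat * nat =>
    q ^ (4 * p.1.1%:Z ^+ 2 + 3 * p.1.2%:Z ^+ 2 + 2 * p.2%:Z ^+ 2 + 4 * p.1.1%:Z * p.1.2%:Z
         - 2 * p.1.2%:Z * p.2%:Z + (al * p.1.1%:Z + be * p.1.2%:Z + 2 * ga * p.2%:Z))
    * (iq p.1.1%:Z * iq p.1.2%:Z * iq p.2%:Z)) (S0 + S1).
Proof.
move=> hE h0 h1.
have [N [N0 hN]] := qfact_inv_bounded Kc B1.
pose b (p : nat * nat * nat) := N * N * N * `|q| ^ (- c) * (`|q| ^+ p.1.1 * `|q| ^+ p.1.2 * `|q| ^+ p.2).
have hb : small_tails b.
  apply: small_tailsZ; first by rewrite !mulr_ge0 ?exprz_ge0 ?normr_ge0 ?(ltW N0).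
  have sq := small_tails_expr_norm Kc q1.
  exact: (small_tails_prod (small_tails_prod sq sq) sq).
apply: (sums_to_prod hb (g := fun p => G al be ga p.1 p.2)).
- move=> p; rewrite /b !normrM mulrC -[leRHS]mulrA; apply: ler_pM => //.
  + by rewrite !mulr_ge0.
  + by rewrite !ler_pM ?mulr_ge0.
  + by rewrite -!exprD; apply: norm_exprz_le => //; rewrite !PoszD; exact: hE.
- by move=> [i j]; exact: sum_over_k.
- have h0' : sums_to (fun p : nat * nat => if odd p.2 then 0 else G al be ga p.1 p.2) S0.
    apply/(@sums_to_inj _ _ _ (fun p : nat * nat => (p.1, (p.2 + p.2)%N))).
    + by move=> [i m] [i' m'] /= [] -> h; congr (_, _); lia.
    + move=> [i j] /= hp; case: ifPn => // jo; case: (hp (i, j./2)) => /=.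
      by congr (_, _); rewrite addnn even_halfK.
    + apply: sums_to_ext h0 => -[i m] /=; by rewrite addnn odd_double.
  have h1' : sums_to (fun p : nat * nat => if odd p.2 then G al be ga p.1 p.2 else 0) S1.
    apply/(@sums_to_inj _ _ _ (fun p : nat * nat => (p.1, (p.2 + p.2).+1%N))).
    + by move=> [i m] [i' m'] /= [] -> h; congr (_, _); lia.
    + move=> [i j] /= hp; case: ifPn => // jo; case: (hp (i, j./2)) => /=.
      by congr (_, _); rewrite addnn -[RHS](odd_double_half j) jo.
    + apply: sums_to_ext h1 => -[i m] /=; by rewrite addnn odd_double.
  apply: sums_to_ext (sums_toD h0' h1') => -[i j] /=.
  by case: ifP; rewrite ?add0r ?addr0.
Qed.

Let T b := triple_product (im * q) 9 b / qpoch_inf B B.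
Let T' b := triple_product B 9 b / qpoch_inf B B.
Let E := qpoch_inf (- q ^ 2) B.
Let O := qpoch_inf (- q ^ 0) B.

Let term (al be ga : int) (p : nat * nat * nat) : K :=
  q ^ (4 * p.1.1%:Z ^+ 2 + 3 * p.1.2%:Z ^+ 2 + 2 * p.2%:Z ^+ 2 + 4 * p.1.1%:Z * p.1.2%:Z
         - 2 * p.1.2%:Z * p.2%:Z + (al * p.1.1%:Z + be * p.1.2%:Z + 2 * ga * p.2%:Z))
    * (iq p.1.1%:Z * iq p.1.2%:Z * iq p.2%:Z).

Lemma G_shift (al be ga : int) (i j m : nat) (c e : int) :
  2 - 2 * j%:Z + 2 * ga = c - 4 * m%:Z ->
  4 * i%:Z ^+ 2 + 3 * j%:Z ^+ 2 + 4 * i%:Z * j%:Z + al * i%:Z + be * j%:Z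
    + (c * m%:Z - 2 * m%:Z ^+ 2 - 2 * m%:Z) = e ->
  G al be ga i j = qpoch_inf (- q ^ c) B * (q ^ e * (iq i%:Z * (qpoch (- q ^ (4 - c)) B m * iq j%:Z))).
Proof.
move=> h1 <-; rewrite /G h1 qpoch_inf_shift.
by rewrite [q ^ (_ + (_ - _))]expfzDr//; ring.
Qed.

Let exponent_bound (al be ga : int) : 0 <= al -> - 2 <= be -> - 1 <= ga -> forall i j k : nat,
  i%:Z + j%:Z + k%:Z <=
     4 * i%:Z ^+ 2 + 3 * j%:Z ^+ 2 + 2 * k%:Z ^+ 2 + 4 * i%:Z * j%:Z - 2 * j%:Z * k%:Z
         + (al * i%:Z + be * j%:Z + 2 * ga * k%:Z) + 4.
Proof.
move=> al0 be2 ga1 i j k.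
(* The quadratic part is 4 i^2 + 4 i j + 2 j^2 + k^2 + (j - k)^2, and the squares of j - 1 and k - 2
   help to absorb the linear terms; [lia] treats the monomials as atoms. *)
have h1 : 0 <= (j%:Z - k%:Z) ^+ 2 by exact: sqr_ge0.
have h2 : 0 <= (j%:Z - 1) ^+ 2 by exact: sqr_ge0.
have h3 : 0 <= (k%:Z - 2) ^+ 2 by exact: sqr_ge0.
have h4 : i%:Z <= i%:Z ^+ 2 by nia.
have h5 : 0 <= al * i%:Z by rewrite mulr_ge0.
have h6 : 0 <= (be + 2) * j%:Z by rewrite mulr_ge0//; lia.
have h7 : 0 <= (ga + 1) * k%:Z by rewrite mulr_ge0//; lia.
have h8 : 0 <= i%:Z * j%:Z by rewrite mulr_ge0.
rewrite !expr2 in h1 h2 h3 h4 *; lia.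
Qed.

Let regroup (a b x y : K) : a * b * (x * y) = b * (a * x * y).
Proof. by ring. Qed.

Lemma triple_sum_1 : sums_to (term 4 2 0) (E * T 5 + q ^+ 5 * O * T' 7).
Proof.
apply: (@triple_sum_parity _ _ _ 4); first exact: exponent_bound.
- apply: sums_to_ext (sums_toZ E (even_double_sum_1 Kc q0 q1 im2)) => -[i m] /=.
  apply/esym/(@G_shift _ _ _ i _ m 2); first by lia.
  by rewrite PoszD; ring.
(* The power q^5 is the prefactor at i = 0, j = 1, with exponent 3 + 2; the same count 3 + [be]
   gives q and q^3 in the second and fourth identities. *)
- apply: sums_to_ext (sums_toZ (q ^+ 5 * O) (odd_double_sum_1 Kc q0 q1 im2)) => -[i m] /=.
  rewrite (@G_shift _ _ _ i _ m 0 _ _ erefl); last by lia.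
  rewrite -/B -/iq -/O regroup [q ^+ _]exprnP -expfzDr//; congr (_ * _).
  by congr (_ ^ _ * _); rewrite -[(m + m).+1]addn1 !PoszD; ring.
Qed.

Lemma triple_sum_2 : sums_to (term 0 (- 2) 0) (E * T 3 + q * O * T' 3).
Proof.
apply: (@triple_sum_parity _ _ _ 4); first exact: exponent_bound.
- apply: sums_to_ext (sums_toZ E (even_double_sum_2 Kc q0 q1 im2)) => -[i m] /=.
  apply/esym/(@G_shift _ _ _ i _ m 2); first by lia.
  by rewrite PoszD; ring.
- apply: sums_to_ext (sums_toZ (q * O) (odd_double_sum_2 Kc q0 q1 im2)) => -[i m] /=.
  rewrite (@G_shift _ _ _ i _ m 0 _ _ erefl); last by lia.
  rewrite -/B -/iq -/O regroup -{1}[q]expr1z -expfzDr//; congr (_ * _).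
  by congr (_ ^ _ * _); rewrite -[(m + m).+1]addn1 !PoszD; ring.
Qed.

Lemma triple_sum_3 : sums_to (term 0 0 (- 1)) (O * T' 1 + q * E * T 7).
Proof.
apply: (@triple_sum_parity _ _ _ 4); first exact: exponent_bound.
- apply: sums_to_ext (sums_toZ O (odd_double_sum_3 Kc q0 q1 im2)) => -[i m] /=.
  apply/esym/(@G_shift _ _ _ i _ m 0); first by lia.
  by rewrite PoszD; ring.
- apply: sums_to_ext (sums_toZ (q * E) (even_double_sum_3 Kc q0 q1 im2)) => -[i m] /=.
  (* For [ga] = -1 and j = 2m + 1 the argument is - q^(2 - 4 (m + 1)), so the shift is by m + 1 and
     the finite product has m + 1 factors. *)
  rewrite (@G_shift _ _ _ i _ m.+1 2 _ _ erefl); last by lia.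
  rewrite -/B -/iq -/E regroup -{1}[q]expr1z -expfzDr//; congr (_ * _).
  by congr (_ ^ _ * _); rewrite -[(m + m).+1]addn1 -[m.+1]addn1 !PoszD; ring.
Qed.

Lemma triple_sum_4 : sums_to (term 0 0 0) (E * T 1 + q ^+ 3 * O * T' 5).
Proof.
apply: (@triple_sum_parity _ _ _ 4); first exact: exponent_bound.
- apply: sums_to_ext (sums_toZ E (even_double_sum_4 Kc q0 q1 im2)) => -[i m] /=.
  apply/esym/(@G_shift _ _ _ i _ m 2); first by lia.
  by rewrite PoszD; ring.
- apply: sums_to_ext (sums_toZ (q ^+ 3 * O) (odd_double_sum_4 Kc q0 q1 im2)) => -[i m] /=.
  rewrite (@G_shift _ _ _ i _ m 0 _ _ erefl); last by lia.
  rewrite -/B -/iq -/O regroup [q ^+ _]exprnP -expfzDr//; congr (_ * _).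
  by congr (_ ^ _ * _); rewrite -[(m + m).+1]addn1 !PoszD; ring.
Qed.

End TripleSums.

(** * Products of modulus 72 *)

Section ProductForms.
Context {K : numFieldType} (Kc : geometrically_complete K).
Variable q : K.
Hypothesis q1 : `|q| < 1.

Lemma J2E (a m : nat) : J2 q a m =
  qpoch_inf (q ^+ a) (q ^+ m) * qpoch_inf (q ^+ (m - a)) (q ^+ m) * qpoch_inf (q ^+ m) (q ^+ m).
Proof. by rewrite /J2 /qpochs_inf !big_cons big_nil mulr1 !mulrA. Qed.

Lemma qpoch_inf_exp_neq0 (a m : nat) : (0 < a)%N -> (0 < m)%N -> qpoch_inf (q ^+ a) (q ^+ m) != 0.
Proof. by move=> a0 m0; apply: (qpoch_inf_neq0 Kc); exact: norm_expr_lt1. Qed.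

(** Both sides of each product identity are broken into these atoms, after which [field] only
    cancels. *)
Let p (u : nat) := qpoch_inf (q ^+ u) (q ^+ 72).

Let p_neq0 (u : nat) : (0 < u)%N -> p u != 0.
Proof. by move=> u0; exact: qpoch_inf_exp_neq0. Qed.

Let split36 (u : nat) : qpoch_inf (q ^+ u) (q ^+ 36) = p u * p (u + 36).
Proof.
by rewrite (qpoch_inf_dissect2 Kc) ?norm_expr_lt1// -exprD -exprM.
Qed.

Let split24 (u : nat) : qpoch_inf (q ^+ u) (q ^+ 24) = p u * p (u + 24) * p (u + 48).
Proof.
by rewrite (qpoch_inf_dissect3 Kc) ?norm_expr_lt1// -!exprM -!exprD.
Qed.

Let split36N (u : nat) : (0 < u)%N ->
  qpoch_inf (- q ^+ u) (q ^+ 36) = p (2 * u) / (p u * p (u + 36)).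
Proof.
move=> u0; have h : qpoch_inf (q ^+ u) (q ^+ 36) * qpoch_inf (- q ^+ u) (q ^+ 36) = p (2 * u).
  by rewrite (qpoch_inf_mulN Kc) ?norm_expr_lt1// -!exprM mulnC.
by rewrite -h split36 mulrC mulKf// mulf_neq0// p_neq0// addn_gt0 u0.
Qed.

(** Separating even and odd powers replaces the base - q^18 by q^36; [split36N] then removes a sign
    of the argument at the cost of doubling the modulus to 72. *)
Let dissect18 (a : K) : qpoch_inf a (- q ^+ 18) =
  qpoch_inf a (q ^+ 36) * qpoch_inf (- (a * q ^+ 18)) (q ^+ 36).
Proof.
rewrite (qpoch_inf_dissect2 Kc) ?normrN ?norm_expr_lt1//.
by rewrite sqrrN -exprM mulrN.
Qed.

Let pos18 (u : nat) : qpoch_inf (q ^+ u) (- q ^+ 18) =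
  p u * p (u + 36) * (p (2 * (u + 18)) / (p (u + 18) * p (u + 18 + 36))).
Proof. by rewrite dissect18 -exprD split36 split36N// addn_gt0 orbT. Qed.

Let neg18 (u : nat) : (0 < u)%N -> qpoch_inf (- q ^+ u) (- q ^+ 18) =
  p (2 * u) / (p u * p (u + 36)) * (p (u + 18) * p (u + 18 + 36)).
Proof. by move=> u0; rewrite dissect18 mulNr opprK -exprD split36 split36N. Qed.

Lemma qpoch_ratio : qpoch_inf (- q ^ 2) (q ^+ 4) / J1 q 4 = J1 q 4 / (J1 q 2 * J1 q 8).
Proof.
rewrite /J1.
have h : qpoch_inf (q ^+ 2) (q ^+ 4) * qpoch_inf (- q ^+ 2) (q ^+ 4) = qpoch_inf (q ^+ 4) (q ^+ 8).
  by rewrite (qpoch_inf_mulN Kc) ?norm_expr_lt1// -!exprM.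
have h2 : qpoch_inf (q ^+ 2) (q ^+ 2) = qpoch_inf (q ^+ 2) (q ^+ 4) * qpoch_inf (q ^+ 4) (q ^+ 4).
  by rewrite (qpoch_inf_dissect2 Kc) ?norm_expr_lt1// -exprM -exprD.
have h4 : qpoch_inf (q ^+ 4) (q ^+ 4) = qpoch_inf (q ^+ 4) (q ^+ 8) * qpoch_inf (q ^+ 8) (q ^+ 8).
  by rewrite (qpoch_inf_dissect2 Kc) ?norm_expr_lt1// -exprM -exprD.
rewrite h2 h4 -h -exprnP.
have n1 := @qpoch_inf_exp_neq0 8 8 isT isT.
have : qpoch_inf (q ^+ 4) (q ^+ 8) != 0 by exact: qpoch_inf_exp_neq0.
rewrite -h mulf_eq0 negb_or => /andP[n2 n3].
by field; rewrite n1 n2 n3.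
Qed.

(** The first factor, 1 + q^0, is the 2 in the second terms of the identities. *)
Lemma qpoch_inf_minus_one : qpoch_inf (- q ^ 0) (q ^+ 4) = 2 * (J1 q 8 / J1 q 4).
Proof.
have h : qpoch_inf (q ^+ 4) (q ^+ 4) * qpoch_inf (- q ^+ 4) (q ^+ 4) = qpoch_inf (q ^+ 8) (q ^+ 8).
  by rewrite (qpoch_inf_mulN Kc) ?norm_expr_lt1// -!exprM.
rewrite expr0z (qpoch_infS Kc) ?norm_expr_lt1// opprK mulN1r /J1 -h.
by field; exact: qpoch_inf_exp_neq0.
Qed.

Lemma triple_product_J2 (b : nat) : (b < 9)%N ->
  triple_product (q ^+ 4) 9 b = J2 q (4 * (9 - b)) 72.
Proof.
move=> b9; rewrite /triple_product J2E -!exprM.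
by rewrite (_ : (4 * (9 + b) = 72 - 4 * (9 - b))%N) //; lia.
Qed.

Lemma odd_part (e b : nat) : (b < 9)%N ->
  q ^+ e * qpoch_inf (- q ^ 0) (q ^+ 4) * (triple_product (q ^+ 4) 9 b / qpoch_inf (q ^+ 4) (q ^+ 4))
  = 2 * q ^+ e * J1 q 8 * J2 q (4 * (9 - b)) 72 / J1 q 4 ^+ 2.
Proof.
move=> b9; rewrite triple_product_J2// qpoch_inf_minus_one -/(J1 q 4).
by field; exact: qpoch_inf_exp_neq0.
Qed.

Lemma J2_24_72 : J2 q 24 72 = J1 q 24.
Proof. by rewrite J2E /J1 split24 /p mulrAC. Qed.

Variable im : K.
Hypothesis im2 : im ^+ 2 = -1.
Let w := im * q.

Let w_even (s : nat) : w ^+ (2 * s) = (-1) ^+ s * q ^+ (2 * s).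
Proof. by rewrite !exprM /w [(im * q) ^+ 2]exprMn im2 mulN1r [LHS]exprNn. Qed.

Let wE (s : nat) : w ^+ (2 * s) = if odd s then - q ^+ (2 * s) else q ^+ (2 * s).
Proof. by rewrite w_even -signr_odd; case: (odd s); rewrite ?mulN1r ?mul1r. Qed.

Let w18 : w ^+ (2 * 9) = - q ^+ 18. Proof. by rewrite wE. Qed.

Lemma even_part_1 : triple_product w 9 5 = J2 q 4 72 * J2 q 28 72 * J2 q 32 72 * J2 q 36 72
  / (J2 q 14 72 * J2 q 18 72 * J2 q 22 72).
Proof.
rewrite /triple_product w18 (wE 2) (wE 7) /= pos18 !neg18// !J2E -!/(p _).
field.
by rewrite !p_neq0.
Qed.

(** The exponents 6, 12, 18 are all multiples of 6, which is why modulus 24 suffices; the passage to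
    72 only serves to share the atoms. *)
Lemma even_part_2 : triple_product w 9 3 = J1 q 24 * J2 q 12 24 / J2 q 6 24.
Proof.
rewrite /triple_product w18 (wE 3) (wE 6) /= pos18 !neg18// !J2E /J1 !split24.
field.
by rewrite !p_neq0.
Qed.

Lemma even_part_3 : triple_product w 9 7 = J2 q 4 72 * J2 q 16 72 * J2 q 20 72 * J2 q 36 72
  / (J2 q 2 72 * J2 q 18 72 * J2 q 34 72).
Proof.
rewrite /triple_product w18 (wE 1) (wE 8) /= pos18 !neg18// !J2E -!/(p _).
field.
by rewrite !p_neq0.
Qed.

Lemma even_part_4 : triple_product w 9 1 = J2 q 8 72 * J2 q 20 72 * J2 q 28 72 * J2 q 36 72
  / (J2 q 10 72 * J2 q 18 72 * J2 q 26 72).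
Proof.
rewrite /triple_product w18 (wE 4) (wE 5) /= pos18 !neg18// !J2E -!/(p _).
field.
by rewrite !p_neq0.
Qed.

End ProductForms.

(** * The four identities, for nonzero q and for q = 0 *)

Section Theorem1p4.
Context {K : numFieldType} (Kc : geometrically_complete K).
Variables (q im : K).
Hypotheses (q1 : `|q| < 1) (im2 : im ^+ 2 = -1).

Let rhs_1 := J1 q 4 * J2 q 4 72 * J2 q 28 72 * J2 q 32 72 * J2 q 36 72
         / (J1 q 2 * J1 q 8 * J2 q 14 72 * J2 q 18 72 * J2 q 22 72)
         + 2 * q ^+ 5 * J1 q 8 * J2 q 8 72 / J1 q 4 ^+ 2.
Let rhs_2 := J1 q 4 * J1 q 24 * J2 q 12 24 / (J1 q 2 * J1 q 8 * J2 q 6 24)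
         + 2 * q * J1 q 8 * J1 q 24 / J1 q 4 ^+ 2.
Let rhs_3 := q * J1 q 4 * J2 q 4 72 * J2 q 16 72 * J2 q 20 72 * J2 q 36 72
         / (J1 q 2 * J1 q 8 * J2 q 2 72 * J2 q 18 72 * J2 q 34 72)
         + 2 * J1 q 8 * J2 q 32 72 / J1 q 4 ^+ 2.
Let rhs_4 := J1 q 4 * J2 q 8 72 * J2 q 20 72 * J2 q 28 72 * J2 q 36 72
         / (J1 q 2 * J1 q 8 * J2 q 10 72 * J2 q 18 72 * J2 q 26 72)
         + 2 * q ^+ 3 * J1 q 8 * J2 q 16 72 / J1 q 4 ^+ 2.

Let lhs_1 (p : nat * nat * nat) := triple_term q (4 * p.1.1%:Z + 2 * p.1.2%:Z) p.1.1 p.1.2 p.2.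
Let lhs_2 (p : nat * nat * nat) := triple_term q (- (2 * p.1.2%:Z)) p.1.1 p.1.2 p.2.
Let lhs_3 (p : nat * nat * nat) := triple_term q (- (2 * p.2%:Z)) p.1.1 p.1.2 p.2.
Let lhs_4 (p : nat * nat * nat) := triple_term q 0 p.1.1 p.1.2 p.2.

Let triple_termE (l e : int) (i j k : nat) :
  4 * i%:Z ^+ 2 + 3 * j%:Z ^+ 2 + 2 * k%:Z ^+ 2 + 4 * i%:Z * j%:Z - 2 * j%:Z * k%:Z + l = e ->
  q ^ e * (qfact_inv (q ^+ 4) i%:Z * qfact_inv (q ^+ 4) j%:Z * qfact_inv (q ^+ 4) k%:Z)
  = triple_term q l i j k.
Proof. by move=> <-; rewrite /triple_term !invfM. Qed.

Lemma triple_sums_nonzero : q != 0 ->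
  [/\ sums_to lhs_1 rhs_1, sums_to lhs_2 rhs_2, sums_to lhs_3 rhs_3 & sums_to lhs_4 rhs_4].
Proof.
move=> q0.
have even (X Y c : K) : c * qpoch_inf (- q ^ 2) (q ^+ 4) * (X / Y / qpoch_inf (q ^+ 4) (q ^+ 4))
    = c * (J1 q 4 / (J1 q 2 * J1 q 8)) * (X / Y).
  by rewrite -(qpoch_ratio Kc q1) /J1; ring.
split.
- have -> : rhs_1 = qpoch_inf (- q ^ 2) (q ^+ 4) * (triple_product (im * q) 9 5 / qpoch_inf (q ^+ 4) (q ^+ 4))
      + q ^+ 5 * qpoch_inf (- q ^ 0) (q ^+ 4) * (triple_product (q ^+ 4) 9 7 / qpoch_inf (q ^+ 4) (q ^+ 4)).
    rewrite (odd_part Kc q1 5 (b := 7) isT) (even_part_1 Kc q1 im2).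
    by rewrite -[qpoch_inf (- q ^ 2) _]mul1r even /rhs_1; congr (_ + _); rewrite !invfM; ring.
  apply: sums_to_ext (triple_sum_1 Kc q0 q1 im2) => -[[i j] k].
  by apply: triple_termE => /=; ring.
- have -> : rhs_2 = qpoch_inf (- q ^ 2) (q ^+ 4) * (triple_product (im * q) 9 3 / qpoch_inf (q ^+ 4) (q ^+ 4))
      + q * qpoch_inf (- q ^ 0) (q ^+ 4) * (triple_product (q ^+ 4) 9 3 / qpoch_inf (q ^+ 4) (q ^+ 4)).
    rewrite -{3}[q]expr1 (odd_part Kc q1 1 (b := 3) isT) (even_part_2 Kc q1 im2).
    rewrite (J2_24_72 Kc q1).
    by rewrite -[qpoch_inf (- q ^ 2) _]mul1r even /rhs_2; congr (_ + _); rewrite !invfM; ring.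
  apply: sums_to_ext (triple_sum_2 Kc q0 q1 im2) => -[[i j] k].
  by apply: triple_termE => /=; ring.
- have -> : rhs_3 = qpoch_inf (- q ^ 0) (q ^+ 4) * (triple_product (q ^+ 4) 9 1 / qpoch_inf (q ^+ 4) (q ^+ 4))
      + q * qpoch_inf (- q ^ 2) (q ^+ 4) * (triple_product (im * q) 9 7 / qpoch_inf (q ^+ 4) (q ^+ 4)).
    rewrite -[qpoch_inf (- q ^ 0) _]mul1r -{1}[1](expr0 q) (odd_part Kc q1 0 (b := 1) isT).
    by rewrite (even_part_3 Kc q1 im2) even /rhs_3 addrC; congr (_ + _); rewrite !invfM; ring.
  apply: sums_to_ext (triple_sum_3 Kc q0 q1 im2) => -[[i j] k].
  by apply: triple_termE => /=; ring.
- have -> : rhs_4 = qpoch_inf (- q ^ 2) (q ^+ 4) * (triple_product (im * q) 9 1 / qpoch_inf (q ^+ 4) (q ^+ 4))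
      + q ^+ 3 * qpoch_inf (- q ^ 0) (q ^+ 4) * (triple_product (q ^+ 4) 9 5 / qpoch_inf (q ^+ 4) (q ^+ 4)).
    rewrite (odd_part Kc q1 3 (b := 5) isT) (even_part_4 Kc q1 im2).
    by rewrite -[qpoch_inf (- q ^ 2) _]mul1r even /rhs_4; congr (_ + _); rewrite !invfM; ring.
  apply: sums_to_ext (triple_sum_4 Kc q0 q1 im2) => -[[i j] k].
  by apply: triple_termE => /=; ring.
Qed.

Lemma triple_sums_zero : q = 0 ->
  [/\ sums_to lhs_1 rhs_1, sums_to lhs_2 rhs_2, sums_to lhs_3 rhs_3 & sums_to lhs_4 rhs_4].
Proof.
move=> q0.
have qz (n : nat) : (0 < n)%N -> q ^+ n = 0 by move=> n0; rewrite q0 expr0n gtn_eqF.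
have p1 (n : nat) : qpoch 0 0 n = 1 :> K.
  by rewrite /qpoch big1// => i _; rewrite mul0r subr0.
have pinf : qpoch_inf 0 0 = 1 :> K.
  apply: qpoch_inf_eq; first by rewrite normr0.
  by under eq_fun do rewrite p1; exact: cvg_cst.
have J1z m : (0 < m)%N -> J1 q m = 1 by move=> m0; rewrite /J1 qz.
have J2z a m : (0 < a < m)%N -> J2 q a m = 1.
  by move=> h; rewrite J2E !qz ?pinf ?mulr1//; lia.
(* An integer power of 0 is 1 at exponent 0 and 0 otherwise, so each sum counts the zeros of the
   exponent. *)
have tE l i j k : triple_term q l i j k =
    (4 * i%:Z ^+ 2 + 3 * j%:Z ^+ 2 + 2 * k%:Z ^+ 2 + 4 * i%:Z * j%:Z - 2 * j%:Z * k%:Z + l == 0)%:R.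
  by rewrite /triple_term (qz 4)// !p1 !mulr1 invr1 mulr1 q0 exp0rz; case: eqP.
have hints (i j k : nat) : [/\ 0 <= i%:Z * j%:Z, 0 <= (j%:Z - k%:Z) ^+ 2, i%:Z <= i%:Z ^+ 2,
    j%:Z <= j%:Z ^+ 2 & k%:Z <= k%:Z ^+ 2].
  by split; [rewrite mulr_ge0 | exact: sqr_ge0 | nia | nia | nia].
split.
- have -> : rhs_1 = lhs_1 (0, 0, 0)%N.
    by rewrite /rhs_1 /lhs_1 !J1z// !J2z// qz// tE /= !(mulr0, mul0r, addr0, mulr1, divr1, invr1).
  apply: sums_to_single => -[[i j] k] /eqP h; rewrite /lhs_1 tE /=; case: eqP => // e; case: h.
  have [h1 h2 h3 h4 h5] := hints i j k; rewrite !expr2 in e h1 h2 h3 h4 h5.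
  by congr (_, _, _); lia.
- have -> : rhs_2 = lhs_2 (0, 0, 0)%N.
    by rewrite /rhs_2 /lhs_2 !J1z// !J2z// tE q0 /= !(mulr0, mul0r, addr0, mulr1, divr1, invr1).
  apply: sums_to_single => -[[i j] k] /eqP h; rewrite /lhs_2 tE /=; case: eqP => // e; case: h.
  have [h1 h2 h3 h4 h5] := hints i j k; rewrite !expr2 in e h1 h2 h3 h4 h5.
  have k0 : k = 0%N by lia.
  by rewrite k0 in e h2 *; congr (_, _, _); lia.
(* At i = j = 0 the exponent 2 k^2 - 2 k vanishes for k = 0 and k = 1, so this sum is 2, in
   agreement with the term 2 J_8 J_(32,72) / J_4^2. *)
- have -> : rhs_3 = \sum_(p <- [fset (0, 0, 0); (0, 0, 1)]%N) lhs_3 p.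
    rewrite /rhs_3 big_fsetU1 ?inE//= big_seq_fset1 /lhs_3 !J1z// !J2z// !tE q0 /=.
    by rewrite expr1n !(mulr0, mul0r, addr0, add0r, mulr1, divr1, invr1).
  apply: sums_to_fset => -[[i j] k]; rewrite !inE negb_or => /andP[/eqP h /eqP h'].
  rewrite /lhs_3 tE /=; case: eqP => // e; exfalso.
  have [h1 h2 h3 h4 h5] := hints i j k; rewrite !expr2 in e h1 h2 h3 h4 h5.
  have h6 : 0 <= (k%:Z - 1) * (k%:Z - 1) by rewrite -expr2 sqr_ge0.
  have j0 : j = 0%N by lia.
  have i0 : i = 0%N by rewrite j0 in e h2 *; lia.
  have : (k = 0 \/ k = 1)%N by rewrite i0 j0 in e; nia.
  by case=> k0; [apply: h | apply: h']; rewrite i0 j0 k0.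
- have -> : rhs_4 = lhs_4 (0, 0, 0)%N.
    by rewrite /rhs_4 /lhs_4 !J1z// !J2z// qz// tE /= !(mulr0, mul0r, addr0, mulr1, divr1, invr1).
  apply: sums_to_single => -[[i j] k] /eqP h; rewrite /lhs_4 tE /=; case: eqP => // e; case: h.
  have [h1 h2 h3 h4 h5] := hints i j k; rewrite !expr2 in e h1 h2 h3 h4 h5.
  by congr (_, _, _); lia.
Qed.

Lemma triple_sums :
  [/\ sums_to lhs_1 rhs_1, sums_to lhs_2 rhs_2, sums_to lhs_3 rhs_3 & sums_to lhs_4 rhs_4].
Proof. by have [/triple_sums_zero|/triple_sums_nonzero] := eqVneq q 0. Qed.

End Theorem1p4.

Theorem theorem1p4 (R : realType) (q : R[i]) (hq : `|q| < 1) :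
  [/\ sums_to
        (fun '(i, j, k) => triple_term q (4 * i%:Z + 2 * j%:Z) i j k)
        (J1 q 4 * J2 q 4 72 * J2 q 28 72 * J2 q 32 72 * J2 q 36 72
         / (J1 q 2 * J1 q 8 * J2 q 14 72 * J2 q 18 72 * J2 q 22 72)
         + 2 * q ^+ 5 * J1 q 8 * J2 q 8 72 / J1 q 4 ^+ 2),
      sums_to
        (fun '(i, j, k) => triple_term q (- (2 * j%:Z)) i j k)
        (J1 q 4 * J1 q 24 * J2 q 12 24 / (J1 q 2 * J1 q 8 * J2 q 6 24)
         + 2 * q * J1 q 8 * J1 q 24 / J1 q 4 ^+ 2),
      sums_to
        (fun '(i, j, k) => triple_term q (- (2 * k%:Z)) i j k)
        (q * J1 q 4 * J2 q 4 72 * J2 q 16 72 * J2 q 20 72 * J2 q 36 72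
         / (J1 q 2 * J1 q 8 * J2 q 2 72 * J2 q 18 72 * J2 q 34 72)
         + 2 * J1 q 8 * J2 q 32 72 / J1 q 4 ^+ 2)
    & sums_to
        (fun '(i, j, k) => triple_term q 0 i j k)
        (J1 q 4 * J2 q 8 72 * J2 q 20 72 * J2 q 28 72 * J2 q 36 72
         / (J1 q 2 * J1 q 8 * J2 q 10 72 * J2 q 18 72 * J2 q 26 72)
         + 2 * q ^+ 3 * J1 q 8 * J2 q 16 72 / J1 q 4 ^+ 2)].
Proof.
have [h1 h2 h3 h4] := triple_sums (@complex_geometrically_complete R) hq (sqr_i R).
by split; [apply: sums_to_ext h1 | apply: sums_to_ext h2 | apply: sums_to_ext h3
          | apply: sums_to_ext h4] => -[[i j] k].
Qed.
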